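(* Consider the multi-task model $y_t=X_t\beta_t^*+W_t$, $t=1,\dots,T$, for $M\ge2$ and $T,n\ge1$. Assume that $W\in\mathbb{R}^N$, $N=nT$, is a random vector with i.i.d. $\mathcal{N}(0,\sigma^2)$ Gaussian components, $\sigma^2>0$, and that all diagonal elements of the matrix $X^\top X/n$ are equal to $1$. Set $$\lambda=\frac{2\sqrt2\,\sigma}{\sqrt{nT}}\Bigl(1+\frac{A\log M}{T}\Bigr)^{1/2},$$ where $A>5/2$. Then with probability at least $1-2M^{1-2A/5}$, for any solution $\hat\beta$ of problem (MT) we have $$\frac1{nT}\|X(\hat\beta-\beta^* )\|^2\le\frac{8\sqrt2\,\sigma}{\sqrt{nT}}\Bigl(1+\frac{A\log M}{T}\Bigr)^{1/2}\|\beta^*\|_{2,1}.$$ Moreover, if in addition $M(\beta^* )\le s$ and Assumption RE-MT($s$) holds with $\kappa_{\rm MT}=\kappa_{\rm MT}(s)$, then with probability at least $1-2M^{1-2A/5}$, for any solution $\hat\beta$ of (MT) we have $$\frac1{nT}\|X(\hat\beta-\beta^* )\|^2\le\frac{128\,\sigma^2}{\kappa_{\rm MT}^2}\,\frac sn\Bigl(1+\frac{A\log M}{T}\Bigr),$$ $$\frac1{\sqrt T}\|\hat\beta-\beta^*\|_{2,1}\le\frac{32\sqrt2\,\sigma}{\kappa_{\rm MT}^2}\,\frac s{\sqrt n}\Bigl(1+\frac{A\log M}{T}\Bigr)^{1/2},$$ $$M(\hat\beta)\le\frac{64\,\phi_{\rm MT}}{\kappa_{\rm MT}^2}\,s,$$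 where $\phi_{\rm MT}$ is the largest eigenvalue of the matrix $X^\top X/n$. Finally, if in addition $\kappa_{\rm MT}(2s)>0$ (that is, Assumption RE-MT($2s$) holds with $\kappa_{\rm MT}(2s)$), then with the same probability for any solution $\hat\beta$ of (MT) we have $$\frac1{\sqrt T}\|\hat\beta-\beta^*\|\le\frac{16\sqrt5\,\sigma}{\kappa_{\rm MT}^2(2s)}\sqrt{\frac sn}\Bigl(1+\frac{A\log M}{T}\Bigr)^{1/2}.$$
   Context: $\mathbb{N}_\ell=\{1,\dots,\ell\}$. Multi-task model: for $t\in\mathbb{N}_T$, $X_t$ is a deterministic $n\times M$ matrix, $\beta_t^*\in\mathbb{R}^M$ is unknown, $y_t\in\mathbb{R}^n$ is observed, $W_t\in\mathbb{R}^n$ is noise, and $y_t=X_t\beta_t^*+W_t$. The vectors $\beta^*\in\mathbb{R}^{MT}$, $y,W\in\mathbb{R}^{nT}$ are obtained by stacking the $\beta^*_t$, $y_t$, $W_t$, and $X$ is the $nT\times MT$ block diagonal matrix with blocks $X_1,\dots,X_T$, so that $y=X\beta^*+W$. For $\beta\in\mathbb{R}^{MT}$ with entries $\beta_{tj}$ ($t\in\mathbb{N}_T$, $j\in\mathbb{N}_M$): $\beta^j=(\beta_{tj})_{t\in\mathbb{N}_T}\in\mathbb{R}^T$; $\|\cdot\|$ is the Euclidean norm; $\|\beta\|_{2,1}=\sum_{j=1}^M\|\beta^j\|$; $J(\beta)=\{j\in\mathbb{N}_M:\beta^j\neq0\}$; $M(\beta)=|J(\beta)|$. For $J\subseteq\mathbb{N}_M$,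 $\beta_J$ has blocks $\beta^j$ for $j\in J$ and $0$ for $j\notin J$; $J^c=\mathbb{N}_M\setminus J$. Problem (MT), with $\lambda>0$: $$\min\Bigl\{\frac1T\sum_{t=1}^T\frac1n\|X_t\beta_t-y_t\|^2+2\lambda\sum_{j=1}^M\Bigl(\sum_{t=1}^T\beta_{tj}^2\Bigr)^{1/2}:\ \beta_1,\dots,\beta_T\in\mathbb{R}^M\Bigr\}.$$ $s$ is an integer with $1\le s\le M$. Assumption RE-MT($s$): there exists a positive number $\kappa_{\rm MT}=\kappa_{\rm MT}(s)$ such that $$\min\Bigl\{\frac{\|X\Delta\|}{\sqrt n\,\|\Delta_J\|}:\ |J|\le s,\ \Delta\in\mathbb{R}^{MT}\setminus\{0\},\ \|\Delta_{J^c}\|_{2,1}\le3\|\Delta_J\|_{2,1}\Bigr\}\ge\kappa_{\rm MT}.$$ RE-MT($2s$) is the same condition with $s$ replaced by $2s$ and $\kappa_{\rm MT}(s)$ by $\kappa_{\rm MT}(2s)$. *)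

(* Defs.v *)
From HB Require Import structures.
From mathcomp Require Import all_boot all_order all_algebra.
From mathcomp Require Import all_classical all_reals all_analysis.

Set Implicit Arguments.
Unset Strict Implicit.
Unset Printing Implicit Defensive.

Import Order.TTheory GRing.Theory Num.Theory.

Local Open Scope classical_set_scope.
Local Open Scope ring_scope.

(* R^{mT}, seen as T stacked blocks of size m.  The t-th block of b is
   [submxcol b t], and \mxcol_(t < T) b_t stacks the blocks b_t. *)
Definition stacked (R : Type) (T m : nat) : Type :=
  'cV[R]_(\sum_(t < T) m)%N.

Section MultiTask.
Context {R : realType}.

(* Euclidean norm (the library norm `|_| on matrices is the sup norm). *)
Definition enorm (k : nat) (v : 'cV[R]_k) : R :=
  Num.sqrt (\sum_(i < k) v i 0 ^+ 2).

Definition blockdiag (T n M : nat) (X : 'I_T -> 'M[R]_(n, M)) :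
    'M[R]_(\sum_(t < T) n, \sum_(t < T) M) :=
  \mxblock_(t < T, u < T) (if t == u then X t else 0).

Definition gram (T n M : nat) (X : 'I_T -> 'M[R]_(n, M)) :
    'M[R]_(\sum_(t < T) M) :=
  n%:R^-1 *: ((blockdiag X)^T *m blockdiag X).

Section Coefficients.
Variables (T M : nat).
Implicit Types (beta : stacked R T M) (J : {set 'I_M}).

Definition task beta (t : 'I_T) : 'cV[R]_M := submxcol beta t.

Definition feature beta (j : 'I_M) : 'cV[R]_T := \col_(t < T) task beta t j 0.

Definition norm21 beta : R := \sum_(j < M) enorm (feature beta j).

Definition restr J beta : stacked R T M :=
  \mxcol_(t < T) \col_(j < M) (if j \in J then task beta t j 0 else 0).

Definition supp beta : {set 'I_M} := [set j | feature beta j != 0]%SET.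

End Coefficients.

Definition objective (T n M : nat) (X : 'I_T -> 'M[R]_(n, M))
    (y : 'I_T -> 'cV[R]_n) (lambda : R) (beta : stacked R T M) : R :=
  T%:R^-1 * (\sum_(t < T) n%:R^-1 * enorm (X t *m task beta t - y t) ^+ 2)
  + 2 * lambda * \sum_(j < M) Num.sqrt (\sum_(t < T) task beta t j 0 ^+ 2).

Definition MT_solution (T n M : nat) (X : 'I_T -> 'M[R]_(n, M))
    (y : 'I_T -> 'cV[R]_n) (lambda : R) (betahat : stacked R T M) : Prop :=
  forall beta : stacked R T M,
    objective X y lambda betahat <= objective X y lambda beta.

(* On this set Delta_J is nonzero, as Delta_J = 0 would force Delta = 0 through
   the cone constraint; so no ratio involves a division by zero. *)
Definition RE_ratios (T n M : nat) (X : 'I_T -> 'M[R]_(n, M)) (s : nat) :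
    set R :=
  [set r | exists (J : {set 'I_M}) (Delta : stacked R T M),
    [/\ (#|J| <= s)%N, Delta <> 0,
        norm21 (restr (~: J)%SET Delta) <= 3 * norm21 (restr J Delta) &
        r = enorm (blockdiag X *m Delta) /
              (Num.sqrt n%:R * enorm (restr J Delta))]].

Definition RE_MT (T n M : nat) (X : 'I_T -> 'M[R]_(n, M)) (s : nat)
    (kappa : R) : Prop :=
  0 < kappa /\ lbound (RE_ratios X s) kappa.

Definition largest_eigenvalue (k : nat) (G : 'M[R]_k) (phi : R) : Prop :=
  eigenvalue G phi /\ forall a : R, eigenvalue G a -> a <= phi.

Section Probability.
Context (d : measure_display) (Omega : measurableType d)
  (P : probability Omega R).

Definition mutually_independent (I : finType) (Z : I -> {RV P >-> R}) : Prop :=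
  forall (K : {set I}) (B : I -> set R), (forall i, measurable (B i)) ->
    P (\bigcap_(i in [set` K]) (Z i @^-1` B i)) =
    (\prod_(i in K) P (Z i @^-1` B i))%E.

Definition normally_distributed (m sigma : R) (Z : {RV P >-> R}) : Prop :=
  forall B : set R, measurable B -> distribution P Z B = normal_prob m sigma B.

(* Inner form of P(Q) >= p, as Q quantifies over all minimizers and is not
   known a priori to be measurable. *)
Definition with_prob_at_least (p : R) (Q : Omega -> Prop) : Prop :=
  exists E : set Omega,
    [/\ measurable E, (p%:E <= P E)%E & forall omega, E omega -> Q omega].

End Probability.

End MultiTask.

(* Main.v *)
(* Let V = X^T W. If every feature block satisfies |V^j| / (nT) <= lambda / 2,
   then comparing the objective at betahat and betastar yields, for
   d = betahat - betastar,
     |X d|^2 / (nT) + lambda |d|_{2,1}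
        <= 2 lambda (|d|_{2,1} + |betastar|_{2,1} - |betahat|_{2,1}),
   hence the slow rate, the cone constraint on d and, through the restricted
   eigenvalue condition, the fast rates. Shrinking one active block of betahat
   gives |(X^T X d)^j| / (nT) >= lambda / 2 on its support, and the sparsity
   bound follows from the Rayleigh quotient of X^T X / n, whose maximiser over
   the sphere is an eigenvector.
   The squared norm |V^j|^2 / (n sigma^2) is a sum of T independent squared
   standard normal variables, so Chernoff's bound and a union bound over the
   M features control the noise. *)

Require Import Defs.
From mathcomp Require Import all_boot all_order all_algebra.
From mathcomp Require Import all_classical all_reals all_analysis.
From mathcomp Require Import measurable_realfun ring lra.

Set Implicit Arguments.
Unset Strict Implicit.
Unset Printing Implicit Defensive.

Import Order.TTheory GRing.Theory Num.Theory.
Import numFieldNormedType.Exports.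

Local Open Scope classical_set_scope.
Local Open Scope ring_scope.

(** * Gaussian tail bound *)

Lemma in_preimage (T U : Type) (f : T -> U) (B : set U) x :
  (x \in f @^-1` B) = (f x \in B).
Proof. by apply/idP/idP; rewrite !inE. Qed.

(** * Change of variables, from indicators to nonnegative functions *)

Section StandardMachine.
Local Open Scope ereal_scope.
Import HBNNSimple.

(** The hypothesis on sets says that [mu], weighted by [g] and pushed forward by [Z], is [c] times
    [nu]; linearity and monotone convergence along [nnsfun_approx] carry this over to [f]. It is
    used to integrate against a density, to transfer a law, and to split one factor off a product of
    independent ones. *)
Lemma ge0_integral_weighted_map d1 d2 (T1 : measurableType d1)
    (T2 : measurableType d2) (R : realType)
    (mu : {measure set T1 -> \bar R}) (nu : {measure set T2 -> \bar R})
    (Z : T1 -> T2) (g : T1 -> R) (f : T2 -> R) (c : R) :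
    measurable_fun setT Z -> measurable_fun setT g ->
    (forall x, 0 <= g x)%R -> (0 <= c)%R ->
    (forall B, measurable B ->
      \int[mu]_(x in Z @^-1` B) (g x)%:E = c%:E * nu B) ->
    measurable_fun setT f -> (forall y, 0 <= f y)%R ->
    \int[mu]_x (g x * f (Z x))%:E = c%:E * \int[nu]_y (f y)%:E.
Proof.
move=> mZ mg g0 c0 gB /measurable_EFinP mf f0.
pose f_ := nnsfun_approx measurableT mf.
have mfZ n : measurable_fun setT (EFin \o f_ n \o Z).
  by do 2 apply: measurableT_comp => //.
have mg' : measurable_fun setT (EFin \o g) by exact/measurable_EFinP.
have indZ (A : set T2) x : measurable A ->
    (g x)%:E * (\1_A (Z x))%:E = ((EFin \o g) \_ (Z @^-1` A)) x.
  move=> mA; rewrite /patch indicE in_preimage.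
  by case: ifP => _; rewrite ?mule1 ?mule0.
have simple n : \int[mu]_x ((g x)%:E * (f_ n (Z x))%:E) =
    c%:E * \int[nu]_y (f_ n y)%:E.
  have EF y : (f_ n y)%:E =
      \sum_(k \in range (f_ n)) (k%:E * (\1_(f_ n @^-1` [set k]) y)%:E).
    by rewrite fsumEFin //= fimfunE.
  have mA k : measurable (f_ n @^-1` [set k]) by [].
  have mAZ k : measurable_fun setT
      (fun x => (g x)%:E * (\1_(f_ n @^-1` [set k]) (Z x))%:E).
    apply: emeasurable_funM => //; apply/measurable_EFinP.
    by apply: measurableT_comp => //; exact: measurable_indic.
  transitivity (\int[mu]_x \sum_(k \in range (f_ n))
      (k%:E * ((g x)%:E * (\1_(f_ n @^-1` [set k]) (Z x))%:E))).
    apply: eq_integral => x _; rewrite EF ge0_mule_fsumr//.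
      by apply: eq_fsbigr => k _; rewrite muleCA.
    by move=> k; exact: nnfun_muleindic_ge0.
  rewrite ge0_integral_fsum //; last 2 first.
  - by move=> k; exact/measurable_funeM.
  - move=> k x _.
    by rewrite muleCA mule_ge0 ?lee_fin//; exact: nnfun_muleindic_ge0.
  under [in RHS]eq_integral do rewrite EF.
  rewrite ge0_integral_fsum //; last 2 first.
  - by move=> k; apply/measurable_funeM/measurable_EFinP/measurable_indic.
  - by move=> k y _; exact: nnfun_muleindic_ge0.
  rewrite ge0_mule_fsumr//; last first.
    move=> k; apply: integral_ge0 => y _; exact: nnfun_muleindic_ge0.
  (* Writing [k] as a value of [f_ n] makes it nonnegative, which pulling it out of the integrals
     requires. *)
  apply: eq_fsbigr => k; rewrite inE => -[y _ <-{k}].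
  rewrite !ge0_integralZl//; first last.
  - by rewrite lee_fin.
  - by move=> x _; rewrite mule_ge0 ?lee_fin.
  - by rewrite lee_fin.
  - by apply/measurable_EFinP/measurable_indic.
  rewrite integral_indic// setIT muleCA; congr (_ * _).
  under eq_integral do rewrite indZ//.
  by rewrite -integral_mkcond gB.
have cvgf y : (EFin \o f_ ^~ y) @ \oo --> (f y)%:E.
  by apply: cvg_nnsfun_approx => // x _; rewrite lee_fin.
rewrite (_ : \int[nu]_y (f y)%:E = 
    limn (fun n => \int[nu]_y (f_ n y)%:E)); last first.
  rewrite -monotone_convergence//; last 3 first.
  - by move=> n; exact/measurable_EFinP/measurable_funP.
  - by move=> n y _; rewrite lee_fin.
  - by move=> y _ m n mn; rewrite lee_fin; exact/lefP/nd_nnsfun_approx.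
  by apply: eq_integral => y _; apply/esym/cvg_lim => //; exact: cvgf.
transitivity (limn (fun n => \int[mu]_x ((g x)%:E * (f_ n (Z x))%:E))).
  rewrite -monotone_convergence//; last 3 first.
  - by move=> n; apply: emeasurable_funM => //; exact: mfZ.
  - by move=> n y _; rewrite mule_ge0// lee_fin.
  - move=> y _ m n mn; rewrite lee_pmul//; rewrite ?lee_fin//.
    exact/lefP/nd_nnsfun_approx.
  apply: eq_integral => x _; apply/esym/cvg_lim => //.
  by rewrite EFinM; apply: cvgeZl => //; exact: cvgf.
under eq_fun do rewrite simple.
apply/cvg_lim => //; apply: cvgeZl => //.
(* The limit on the right exists because the integrals of an increasing sequence increase. *)
apply: ereal_nondecreasing_is_cvgn => m n mn.
apply: ge0_le_integral => //.
- by move=> y _; rewrite lee_fin.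
- exact/measurable_EFinP/measurable_funP.
- exact/measurable_EFinP/measurable_funP.
- by move=> y _; rewrite lee_fin; exact/lefP/nd_nnsfun_approx.
Qed.
End StandardMachine.

(** * Gaussian integrals *)

Section NormalIntegrals.
Context {R : realType}.
Implicit Types (m s a u : R) (f : R -> R).

Lemma ge0_integral_normal_prob m s f :
    measurable_fun setT f -> (forall x, 0 <= f x) ->
  (\int[normal_prob m s]_x (f x)%:E =
   \int[lebesgue_measure]_x (normal_pdf m s x * f x)%:E)%E.
Proof.
move=> mf f0; rewrite -[LHS]mul1e.
rewrite (@ge0_integral_weighted_map _ _ _ _ _ lebesgue_measure (normal_prob m s)
  id (normal_pdf m s) f 1)//.
- exact: measurable_normal_pdf.
- exact: normal_pdf_ge0.
- by move=> B mB; rewrite mul1e.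
Qed.

Lemma normal_pdfxE m s x : s != 0 ->
  normal_pdf m s x = normal_peak s * normal_fun m s x.
Proof. by move=> s0; rewrite normal_pdfE. Qed.

(** Completing the square turns the tilted density into a constant times the normal density of mean
    [a * s ^+ 2], which has mass 1. *)
Lemma integral_normal_expR s a : s != 0 ->
  (\int[normal_prob 0 s]_x (expR (a * x))%:E =
   (expR (a ^+ 2 * s ^+ 2 / 2))%:E)%E.
Proof.
move=> s0.
rewrite ge0_integral_normal_prob; last 2 first.
- by apply: measurableT_comp => //; exact: measurable_funM.
- by move=> x; exact: expR_ge0.
have E x : normal_pdf 0 s x * expR (a * x) =
    expR (a ^+ 2 * s ^+ 2 / 2) * normal_pdf (a * s ^+ 2) s x.
  rewrite !normal_pdfxE// -[LHS]mulrA [RHS]mulrCA; congr (normal_peak s * _).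
  rewrite /normal_fun -!expRD; congr expR.
  by field.
under eq_integral do rewrite E EFinM.
rewrite ge0_integralZl//.
- by rewrite integral_normal_pdf mule1.
- by apply/measurable_EFinP; exact: measurable_normal_pdf.
- by move=> x _; rewrite lee_fin normal_pdf_ge0.
Qed.

(** The integrand is again a centred Gaussian, of variance [(1 - 2 * u)^-1], up to the ratio [s] of
    the two peaks. *)
Lemma integral_normal_expR_sqr u : u < 1 / 2 ->
  (\int[normal_prob 0 1]_x (expR (u * x ^+ 2))%:E =
   ((Num.sqrt (1 - 2 * u))^-1)%:E)%E.
Proof.
move=> u2; have v0 : 0 < 1 - 2 * u by lra.
set s := (Num.sqrt (1 - 2 * u))^-1.
have s0 : 0 < s by rewrite invr_gt0 sqrtr_gt0.
have sE : s ^+ 2 = (1 - 2 * u)^-1 by rewrite exprVn sqr_sqrtr ?ltW.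
rewrite ge0_integral_normal_prob; last 2 first.
- apply: measurableT_comp => //.
  by apply: measurable_funM => //; exact: measurable_funX.
- by move=> x; exact: expR_ge0.
have E x : normal_pdf 0 1 x * expR (u * x ^+ 2) = s * normal_pdf 0 s x.
  rewrite !normal_pdfxE ?oner_eq0 ?gt_eqF// -[LHS]mulrA [RHS]mulrA; congr (_ * _).
    rewrite /normal_peak -!mulrnAr (sqrtrM _ (sqr_ge0 s)) sqrtr_sqr gtr0_norm//.
    by rewrite invfM mulrA divff ?gt_eqF// mul1r expr1n mul1r.
  rewrite /normal_fun -!expRD; congr expR.
  rewrite sE; field; rewrite gt_eqF//.
under eq_integral do rewrite E EFinM.
rewrite ge0_integralZl//.
- by rewrite integral_normal_pdf mule1.
- by apply/measurable_EFinP; exact: measurable_normal_pdf.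
- by move=> x _; rewrite lee_fin normal_pdf_ge0.
- by rewrite lee_fin ltW.
Qed.
End NormalIntegrals.

(** * Expectation of a product of independent variables *)

Section IndependentProduct.
Context {R : realType} (d : measure_display) (Omega : measurableType d)
  (P : probability Omega R).

Lemma measurable_prod_comp (I : finType) (A : pred I) (Z : I -> {RV P >-> R})
    (h : I -> R -> R) :
    (forall i, measurable_fun setT (h i)) ->
  measurable_fun setT (fun w => \prod_(i | A i) h i (Z i w)).
Proof.
move=> mh; under eq_fun do rewrite -big_filter.
apply: measurable_prod => i _; exact: measurableT_comp.
Qed.

Lemma integral_indic_comp (Z : {RV P >-> R}) (B : set R) : measurable B ->
  (\int[P]_w (\1_B (Z w))%:E = P (Z @^-1` B))%E.
Proof.
move=> mB; transitivity (\int[P]_w (\1_(Z @^-1` B) w)%:E)%E.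
  by apply: eq_integral => w _; rewrite !indicE in_preimage.
by rewrite integral_indic ?setIT//; exact: measurable_funPTI.
Qed.

(* The integrands are changed one at a time from indicators, for which the
   identity is the definition of independence, to the given functions. *)
Lemma expectation_prod_indep (I : finType) (Z : I -> {RV P >-> R})
    (h : I -> R -> R) (e : I -> R) :
    mutually_independent Z ->
    (forall i, measurable_fun setT (h i)) -> (forall i x, 0 <= h i x) ->
    (forall i, \int[P]_w (h i (Z i w))%:E = (e i)%:E)%E ->
  (\int[P]_w (\prod_i h i (Z i w))%:E = (\prod_i e i)%:E)%E.
Proof.
(* Induction on the number of indices in [S], where the integrand is arbitrary; outside [S] it is an
   indicator. *)
move=> indZ; suff main n (S : {set I}) (B : I -> set R)
      (h1 : I -> R -> R) (e1 : I -> R) :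
    #|S| = n -> (forall i, measurable (B i)) ->
    (forall i, i \notin S -> h1 i = \1_(B i)) ->
    (forall i, measurable_fun setT (h1 i)) -> (forall i x, 0 <= h1 i x) ->
    (forall i, \int[P]_w (h1 i (Z i w))%:E = (e1 i)%:E)%E ->
  (\int[P]_w (\prod_i h1 i (Z i w))%:E = (\prod_i e1 i)%:E)%E.
  move=> mh h0 he; apply: (main _ [set: I]%SET (fun=> setT)) => // i.
  by rewrite finset.in_setT.
elim: n S B h1 e1 => [|n IH] S B h1 e1.
  move/cards0_eq => -> mB hB mh h0 he.
  have eB i : (e1 i)%:E = P (Z i @^-1` B i).
    rewrite -he hB ?finset.in_set0//.
    by rewrite (integral_indic_comp (Z i) (mB i)).
  transitivity (\int[P]_w
      (\1_(\bigcap_(i in [set` [set: I]%SET]) (Z i @^-1` B i)) w)%:E)%E.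
    apply: eq_integral => w _; congr EFin; rewrite indicE.
    case: (boolP (w \in _)) => [/set_mem wB|wB].
      rewrite big1// => i _; rewrite hB ?finset.in_set0// indicE mem_set//.
      by apply: wB; rewrite /= finset.in_setT.
    have /existsNP[i wi] : ~ forall i, B i (Z i w).
      by move=> allB; move/negP: wB; apply; rewrite inE => i _; exact: allB.
    by rewrite (bigD1 i)//= hB ?finset.in_set0// indicE memNset// mul0r.
  rewrite integral_indic ?setIT//.
    apply: (etrans (indZ [set: I]%SET B mB)).
    by rewrite -prodEFin; apply: eq_big => [i|i _]; rewrite ?finset.in_setT ?eB.
  by apply: fin_bigcap_measurable => // i _; exact: measurable_funPTI.
move=> cS mB hB mh h0 he.
have [i0 i0S] : exists i, i \in S by apply/card_gt0P; rewrite cS.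
have e0 i : 0 <= e1 i.
  by rewrite -lee_fin -he; apply: integral_ge0 => x _; rewrite lee_fin.
rewrite (bigD1 i0)//= mulrC EFinM -he.
have <- : (\int[distribution P (Z i0)]_y (h1 i0 y)%:E =
    \int[P]_w (h1 i0 (Z i0 w))%:E)%E.
  apply: (@ge0_integral_distribution _ _ _ _ _ P (Z i0) (EFin \o h1 i0)).
    exact/measurable_EFinP.
  by move=> y; rewrite lee_fin.
under eq_integral do rewrite (bigD1 i0)//= mulrC.
(* The product of the other factors is taken as the weight, so that only indicators of events on
   [Z i0] have to be treated. *)
apply: (ge0_integral_weighted_map (nu := distribution P (Z i0)) (Z := Z i0)
  (g := fun w => \prod_(i | i != i0) h1 i (Z i w))) => //.
- exact: measurable_prod_comp.
- by move=> w; apply: prodr_ge0.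
- exact: prodr_ge0.
move=> C mC.
(* Integrating the weight over the preimage of [C] amounts to putting an indicator at [i0], which
   the induction hypothesis covers with [S :\ i0]. *)
pose h2 i := if i == i0 then \1_C else h1 i.
pose e2 i := if i == i0 then fine (distribution P (Z i0) C) else e1 i.
have := IH (S :\ i0)%SET (fun i => if i == i0 then C else B i) h2 e2.
have dC : (fine (distribution P (Z i0) C))%:E = distribution P (Z i0) C.
  by rewrite fineK// fin_num_measure.
have h2E w : \prod_i h2 i (Z i w) =
    \prod_(i | i != i0) h1 i (Z i w) * \1_C (Z i0 w).
  rewrite (bigD1 i0)//= /h2 eqxx mulrC; congr (_ * _).
  by apply: eq_bigr => i /negbTE ->.
have e2E : \prod_i e2 i =
    \prod_(i | i != i0) e1 i * fine (distribution P (Z i0) C).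
  rewrite (bigD1 i0)//= /e2 eqxx mulrC; congr (_ * _).
  by apply: eq_bigr => i /negbTE ->.
rewrite e2E EFinM dC => <-.
- rewrite integral_mkcond; apply: eq_integral => w _.
  rewrite h2E /patch indicE in_preimage.
  by case: ifP => _; rewrite ?mulr1 ?mulr0.
- by have := cardsD1 i0 S; rewrite i0S cS => -[].
- by move=> i; case: ifP.
- move=> i; rewrite finset.in_setD1 negb_and negbK /h2.
  by case: eqP => //= _; exact: hB.
- by move=> i; rewrite /h2; case: ifP => // _; exact: measurable_indic.
- by move=> i x; rewrite /h2; case: ifP => // _; rewrite indicE.
- move=> i; rewrite /h2 /e2; case: eqP => [->|_]; last exact: he.
  by rewrite integral_indic_comp// dC.
Qed.
End IndependentProduct.

(** * Moment generating functions and the chi-square tail *)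

Section GaussianQuadraticForms.
Context {R : realType} (d : measure_display) (Omega : measurableType d)
  (P : probability Omega R).

(** The exponential of a linear form is a product over independent coordinates, and each factor is a
    one-dimensional normal moment generating function. *)
Lemma expectation_expR_gaussian (I : finType) (W : I -> {RV P >-> R})
    (sigma : R) (a : I -> R) :
    sigma != 0 -> mutually_independent W ->
    (forall i, normally_distributed 0 sigma (W i)) ->
  (\int[P]_w (expR (\sum_i a i * W i w))%:E =
   (expR (sigma ^+ 2 / 2 * \sum_i a i ^+ 2))%:E)%E.
Proof.
move=> s0 indW nW.
under eq_integral do rewrite expR_sum.
rewrite (expectation_prod_indep (h := fun i x => expR (a i * x))
  (e := fun i => expR (a i ^+ 2 * sigma ^+ 2 / 2)) indW).
- rewrite -expR_sum mulr_sumr; congr (EFin (expR _)).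
  by apply: eq_bigr => i _; field.
- by move=> i; apply: measurableT_comp => //; exact: measurable_funM.
- by move=> i x; exact: expR_ge0.
- move=> i; rewrite -(integral_normal_expR (a i) s0).
  transitivity (\int[P]_w (1 * expR (a i * W i w))%R%:E)%E.
    by apply: eq_integral => w _; rewrite mul1r.
  rewrite (ge0_integral_weighted_map (nu := normal_prob 0 sigma) (c := 1)
    (g := fun=> 1) (Z := W i) (f := fun y => expR (a i * y)))//.
  + by rewrite mul1e.
  + by move=> _ Y mY; rewrite setTI; apply: (measurable_funPTI (W i)).
  + move=> B mB; have mWB : measurable (W i @^-1` B) by exact: measurable_funPTI.
    by apply: (etrans (integral_cst P mWB 1)); rewrite !mul1e; exact: nW.
  + by apply: measurableT_comp => //; exact: measurable_funM.
Qed.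

Variables (T I : finType) (W : T -> I -> {RV P >-> R}) (sigma : R).
Variable x : T -> I -> R.

Local Notation V t w := (\sum_i x t i * W t i w).

Lemma measurable_lincomb (J : finType) (Z : J -> {RV P >-> R}) (a : J -> R) :
  measurable_fun setT (fun w => \sum_j a j * Z j w).
Proof. by apply: measurable_sum => j; exact: measurable_funM. Qed.

Hypothesis sigma0 : sigma != 0.
Hypothesis indW : mutually_independent (fun ti : T * I => W ti.1 ti.2).
Hypothesis nW : forall t i, normally_distributed 0 sigma (W t i).
Hypothesis x1 : forall t, sigma ^+ 2 * \sum_i x t i ^+ 2 = 1.

(* Each factor [expR (u V^2)] is written as [E_g (expR (sqrt (2 u) g V))] with
   [g] standard normal, so that only exponentials of linear forms in the noise
   have to be integrated. *)
Lemma expectation_expR_sum_sqr (u : R) : 0 <= u -> u < 1 / 2 ->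
  (\int[P]_w (expR (u * \sum_t V t w ^+ 2))%:E =
   ((Num.sqrt (1 - 2 * u))^-1 ^+ #|T|)%:E)%E.
Proof.
move=> u0 u2; set C := (Num.sqrt (1 - 2 * u))^-1; set v := Num.sqrt (2 * u).
have C0 : 0 <= C by rewrite invr_ge0 sqrtr_ge0.
have v2 : v ^+ 2 = 2 * u by rewrite sqr_sqrtr// mulr_ge0.
(* Induction on the number of tasks that still carry a square. The others carry arbitrary linear
   forms [a], because linearising a square leaves such a form behind. *)
suff main n (S : {set T}) (a : T -> I -> R) : #|S| = n ->
  (\int[P]_w (expR (\sum_(t in S) u * V t w ^+ 2 +
     \sum_(t | t \notin S) \sum_i a t i * W t i w))%:E =
   (C ^+ n * expR (sigma ^+ 2 / 2 * \sum_(t | t \notin S) \sum_i a t i ^+ 2))%:E)%E.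
  have := main #|T| [set: T]%SET (fun _ _ => 0) (cardsT T).
  rewrite [in X in _ = X -> _]big_pred0 ?mulr0 ?expR0 ?mulr1; last first.
    by move=> t; rewrite finset.in_setT.
  move=> <-; apply: eq_integral => w _; congr (EFin (expR _)).
  rewrite [X in _ + X]big_pred0 ?addr0 ?mulr_sumr; last first.
    by move=> t; rewrite finset.in_setT.
  by apply: eq_bigl => t; rewrite finset.in_setT.
elim: n S a => [|n IH] S a.
  move/cards0_eq => ->.
  under eq_integral do rewrite big_set0 add0r.
  have := expectation_expR_gaussian
    (W := fun ti : T * I => W ti.1 ti.2) (fun ti => a ti.1 ti.2) sigma0 indW
    (fun ti => nW ti.1 ti.2).
  rewrite -(pair_bigA _ (fun t i => a t i ^+ 2))/= expr0 mul1r.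
  under [X in _ -> _ = (expR (_ * X))%:E]eq_bigl do rewrite finset.in_set0.
  move=> <-; apply: eq_integral => w _; congr (EFin (expR _)).
  rewrite -(pair_bigA _ (fun t i => a t i * W t i w))/=.
  by apply: eq_bigl => t; rewrite finset.in_set0.
move=> cS.
have [t0 t0S] : exists t, t \in S by apply/card_gt0P; rewrite cS.
pose S' := (S :\ t0)%SET.
have cS' : #|S'| = n by have := cardsD1 t0 S; rewrite t0S cS => -[].
have t0S' : t0 \notin S' by rewrite finset.in_setD1 eqxx.
have bigS (F : T -> R) : \sum_(t in S) F t = F t0 + \sum_(t in S') F t.
  by rewrite (big_setD1 t0).
have bigSc (F : T -> R) :
    \sum_(t | t \notin S') F t = F t0 + \sum_(t | t \notin S) F t.
  rewrite (bigD1 t0)//=; congr (_ + _); apply: eq_bigl => t.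
  rewrite finset.in_setD1 negb_and negbK.
  by case: eqP => [->|_]; rewrite ?t0S ?andbT.
pose r w := \sum_(t in S') u * V t w ^+ 2 +
  \sum_(t | t \notin S) \sum_i a t i * W t i w.
(* For a fixed value [g] of the auxiliary normal variable, these are the linear coefficients once
   task [t0] has been linearised. *)
pose ag g t i := if t == t0 then v * g * x t0 i else a t i.
have agE (g : R) (F : R -> T -> I -> R) :
    \sum_(t | t \notin S) \sum_i F (ag g t i) t i =
    \sum_(t | t \notin S) \sum_i F (a t i) t i.
  apply: eq_bigr => t tS; apply: eq_bigr => i _.
  by rewrite /ag; case: eqP tS => // ->; rewrite t0S.
pose F (z : Omega * R) := (expR (r z.1 + (v * V t0 z.1) * z.2))%:E.
have mV t : measurable_fun setT (fun w => V t w) by exact: measurable_lincomb.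
have mr : measurable_fun setT r.
  apply: measurable_funD.
    under eq_fun do rewrite -big_filter.
    apply: measurable_sum => t; apply: measurable_funM => //.
    exact: measurable_funX.
  under eq_fun do rewrite -big_filter.
  by apply: measurable_sum => t; exact: measurable_lincomb.
have mF : measurable_fun setT F.
  apply/measurable_EFinP; apply: measurableT_comp => //.
  apply: measurable_funD; first exact: measurableT_comp.
  apply: measurable_funM => //; apply: measurable_funM => //.
  exact: (measurableT_comp (mV t0)).
transitivity (\int[P]_w \int[normal_prob 0 1]_g F (w, g))%E.
  apply: eq_integral => w _; rewrite /F/=.
  under [RHS]eq_integral do rewrite expRD EFinM.
  rewrite ge0_integralZl//; last first.
  - apply/measurable_EFinP.
    by apply: measurableT_comp => //; exact: measurable_funM.
  rewrite integral_normal_expR ?oner_eq0// -EFinM -expRD; congr (EFin (expR _)).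
  rewrite bigS -addrA addrC; congr (_ + _).
  by rewrite exprMn v2; field.
(* The noise is now integrated first, at fixed [g], where the induction hypothesis applies. *)
rewrite fubini_tonelli//; last by move=> z; rewrite lee_fin expR_ge0.
transitivity (\int[normal_prob 0 1]_g
   ((C ^+ n * expR (sigma ^+ 2 / 2 * \sum_(t | t \notin S) \sum_i a t i ^+ 2))%:E
    * (expR (u * g ^+ 2))%:E))%E.
  apply: eq_integral => g _.
  transitivity (\int[P]_w (expR (\sum_(t in S') u * V t w ^+ 2 +
     \sum_(t | t \notin S') \sum_i ag g t i * W t i w))%:E)%E.
    apply: eq_integral => w _; congr (EFin (expR _)).
    rewrite /r/= bigSc (agE g (fun y t i => y * W t i w)) -!addrA; congr (_ + _).
    rewrite addrC; congr (_ + _); rewrite mulr_sumr mulr_suml.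
    by apply: eq_bigr => i _; rewrite /ag eqxx; ring.
  rewrite IH// -EFinM -[X in _ = X%:E]mulrA -expRD bigSc.
  rewrite (agE g (fun y _ _ => y ^+ 2)).
  congr (EFin (_ * expR _)); rewrite mulrDr addrC; congr (_ + _).
  (* Unit variance reduces the exponent left by task [t0] to [u * g ^+ 2], whose integral over [g]
     supplies the last factor [C]. *)
  transitivity (v ^+ 2 * g ^+ 2 / 2 * (sigma ^+ 2 * \sum_i x t0 i ^+ 2)).
    by rewrite !mulr_sumr; apply: eq_bigr => i _; rewrite /ag eqxx; field.
  by rewrite x1 v2; field.
rewrite ge0_integralZl//; last first.
- by rewrite lee_fin mulr_ge0 ?expR_ge0 ?exprn_ge0.
- apply/measurable_EFinP; apply: measurableT_comp => //.
  by apply: measurable_funM => //; exact: measurable_funX.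
by rewrite integral_normal_expR_sqr// -EFinM (exprSr C) -/C [X in _ = X%:E]mulrAC.
Qed.

(** By [x1] the sum of squares is chi-square with [#|T|] degrees of freedom. The term [2 * #|T|%:R]
    of the threshold, times 1/4, cancels the factor [expR (1 / 2)] that each degree of freedom
    contributes. *)
Lemma chi_square_tail (b : R) : 0 <= b ->
  (P [set w | (2 * #|T|%:R + b < \sum_t V t w ^+ 2)%R] <=
   (expR (- (b / 4)))%:E)%E.
Proof.
move=> b0; set E := [set w | _].
have mV2 : measurable_fun setT (fun w => \sum_t V t w ^+ 2).
  by apply: measurable_sum => t; apply: measurable_funX; exact: measurable_lincomb.
have mE : measurable E.
  by rewrite -[E]setTI; apply: measurable_fun_ltr => //; exact: measurable_cst.
(* Chernoff's bound with parameter 1/4: the moment generating function at 1/4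
   is [sqrt 2], which is at most [expR (1 / 2)]. *)
set c := expR (1 / 4 * (2 * #|T|%:R + b)).
have sqrt2 : (Num.sqrt (1 - 2 * (1 / 4)) : R)^-1 <= expR (1 / 2).
  have -> : 1 - 2 * (1 / 4) = 2^-1 :> R by field.
  rewrite sqrtrV// invrK.
  apply: (@le_trans _ _ (1 + 1 / 2)); last exact: expR_ge1Dx.
  have h0 : 0 <= 1 + 1 / 2 :> R by lra.
  rewrite -[leRHS]ger0_norm// -sqrtr_sqr ler_wsqrtr//; lra.
have u0 : 0 <= 1 / 4 :> R by lra.
have u2 : 1 / 4 < 1 / 2 :> R by lra.
have mgf := expectation_expR_sum_sqr u0 u2.
have markovE : (c%:E * P E <= \int[P]_w (expR (1 / 4 * \sum_t V t w ^+ 2))%:E)%E.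
  rewrite -integral_cst//.
  apply: (@le_trans _ _ (\int[P]_(w in E) (expR (1 / 4 * \sum_t V t w ^+ 2))%:E)%E).
    apply: ge0_le_integral => //.
    - by move=> w _; rewrite lee_fin expR_ge0.
    - apply/measurable_EFinP; apply: measurableT_comp => //.
      by apply: measurable_funTS; exact: measurable_funM.
    - move=> w; rewrite /E/= => Ew; rewrite lee_fin ler_expR.
      by rewrite ler_pM2l// ltW.
  apply: ge0_subset_integral => //.
  - apply/measurable_EFinP; apply: measurableT_comp => //.
    exact: measurable_funM.
have c0 : (0 < c%:E)%E by rewrite lte_fin expR_gt0.
rewrite -(lee_pmul2l _ c0)//.
apply: (le_trans markovE); rewrite mgf -EFinM lee_fin -expRD.
apply: (@le_trans _ _ (expR (1 / 2) ^+ #|T|)).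
  by rewrite lerXn2r ?nnegrE ?invr_ge0 ?sqrtr_ge0 ?expR_ge0.
rewrite -expRM_natl ler_expR le_eqVlt; apply/orP; left; apply/eqP.
by field.
Qed.
End GaussianQuadraticForms.

(** * Block norms *)

Section EuclideanNorm.
Context {R : realType}.

Definition dot (k : nat) (u v : 'cV[R]_k) : R := \sum_(i < k) u i 0 * v i 0.

Section Dot.
Variable k : nat.
Implicit Types (u v w : 'cV[R]_k) (a : R).

Lemma dotC u v : dot u v = dot v u.
Proof. by apply: eq_bigr => i _; rewrite mulrC. Qed.

Lemma dotDl u v w : dot (u + v) w = dot u w + dot v w.
Proof. by rewrite -big_split; apply: eq_bigr => i _; rewrite mxE mulrDl. Qed.

Lemma dotZl a u v : dot (a *: u) v = a * dot u v.
Proof. by rewrite mulr_sumr; apply: eq_bigr => i _; rewrite mxE mulrA. Qed.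

Lemma dot0l v : dot 0 v = 0.
Proof. by rewrite /dot big1// => i _; rewrite mxE mul0r. Qed.

Lemma dotNl u v : dot (- u) v = - dot u v.
Proof. by rewrite -scaleN1r dotZl mulN1r. Qed.

Lemma dotDr u v w : dot w (u + v) = dot w u + dot w v.
Proof. by rewrite !(dotC w) dotDl. Qed.

Lemma dotZr a u v : dot v (a *: u) = a * dot v u.
Proof. by rewrite !(dotC v) dotZl. Qed.

Lemma dotNr u v : dot v (- u) = - dot v u.
Proof. by rewrite !(dotC v) dotNl. Qed.

Lemma dot_mulmx (m : nat) (G : 'M[R]_(k, m)) u (v : 'cV_m) :
  dot u (G *m v) = dot (G^T *m u) v.
Proof.
rewrite /dot; under eq_bigr do rewrite mxE mulr_sumr.
rewrite exchange_big; apply: eq_bigr => j _ /=; rewrite mxE mulr_suml.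
by apply: eq_bigr => i _; rewrite mxE; ring.
Qed.

Lemma enorm_ge0 u : 0 <= enorm u. Proof. exact: sqrtr_ge0. Qed.

Lemma sqr_enorm u : enorm u ^+ 2 = dot u u.
Proof.
rewrite sqr_sqrtr; last by apply: sumr_ge0 => i _; exact: sqr_ge0.
by apply: eq_bigr => i _; rewrite expr2.
Qed.

Lemma enormE u : enorm u = Num.sqrt (dot u u).
Proof. by rewrite -sqr_enorm sqrtr_sqr ger0_norm// enorm_ge0. Qed.

Lemma enorm0 : enorm (0 : 'cV[R]_k) = 0.
Proof.
by rewrite /enorm big1 ?sqrtr0// => i _; rewrite mxE expr0n.
Qed.

Lemma enorm_eq0 u : (enorm u == 0) = (u == 0).
Proof.
apply/eqP/eqP => [u0|->]; last exact: enorm0.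
apply/matrixP => i j; rewrite ord1 mxE; apply/eqP; rewrite -sqrf_eq0.
have /eqP : enorm u ^+ 2 = 0 by rewrite u0 expr0n.
rewrite sqr_enorm /dot; under eq_bigr do rewrite -expr2.
rewrite psumr_eq0; last by move=> l _; exact: sqr_ge0.
by move/allP/(_ i); apply; rewrite mem_index_enum.
Qed.

Lemma cauchy_schwarz u v : dot u v <= enorm u * enorm v.
Proof.
have [/eqP|u0] := eqVneq (enorm u) 0.
  by rewrite enorm_eq0 => /eqP ->; rewrite enorm0 mul0r dot0l.
have [/eqP|v0] := eqVneq (enorm v) 0.
  by rewrite enorm_eq0 => /eqP ->; rewrite enorm0 mulr0 dotC dot0l.
have a0 : 0 < enorm u by rewrite lt_def u0 enorm_ge0.
have b0 : 0 < enorm v by rewrite lt_def v0 enorm_ge0.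
(* Expanding this square gives twice the claim multiplied by [enorm u * enorm v]. *)
have := sqr_ge0 (enorm (enorm v *: u - enorm u *: v)).
rewrite sqr_enorm !(dotDl, dotDr, dotNl, dotNr, dotZl, dotZr) -!sqr_enorm.
rewrite (dotC v u) => h.
have ab0 := mulr_gt0 a0 b0.
rewrite -(ler_pM2l ab0); lra.
Qed.

Lemma enormN u : enorm (- u) = enorm u.
Proof. by rewrite !enormE dotNl dotNr opprK. Qed.

Lemma sqr_enormB u v :
  enorm (u - v) ^+ 2 = enorm u ^+ 2 - 2 * dot u v + enorm v ^+ 2.
Proof.
by rewrite !sqr_enorm !(dotDl, dotDr, dotNl, dotNr) (dotC v u); ring.
Qed.

Lemma enormD u v : enorm (u + v) <= enorm u + enorm v.
Proof.
rewrite -(@ler_pXn2r _ 2) ?nnegrE ?addr_ge0 ?enorm_ge0//.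
rewrite sqr_enorm !(dotDl, dotDr) sqrrD -!sqr_enorm (dotC v u).
by have := cauchy_schwarz u v; lra.
Qed.

Lemma enormZ a u : 0 <= a -> enorm (a *: u) = a * enorm u.
Proof.
move=> a0; rewrite !enormE dotZl dotZr mulrA -expr2 sqrtrM ?sqr_ge0//.
by rewrite sqrtr_sqr ger0_norm.
Qed.

End Dot.

(** A matrix and its transpose have the same operator norm: with [v] the image of [z] under the
    transpose, the squared norm of [v] is the inner product of [z] and [G *m v], to which
    Cauchy-Schwarz and the bound on [G] apply. *)
Lemma enorm_tr_mulmx (m k : nat) (G : 'M[R]_(m, k)) (rho : R) : 0 <= rho ->
    (forall v, enorm (G *m v) ^+ 2 <= rho * enorm v ^+ 2) ->
  forall z, enorm (G^T *m z) ^+ 2 <= rho * enorm z ^+ 2.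
Proof.
move=> rho0 hG z; set v := G^T *m z.
have h1 : enorm v ^+ 2 <= enorm z * enorm (G *m v).
  by rewrite sqr_enorm {1}/v -dot_mulmx cauchy_schwarz.
have [v0|v0] := eqVneq (enorm v) 0.
  by rewrite v0 expr0n mulr_ge0 ?sqr_ge0.
have v2 : 0 < enorm v ^+ 2 by rewrite exprn_gt0// lt_def v0 enorm_ge0.
rewrite -(ler_pM2r v2).
apply: (@le_trans _ _ ((enorm z * enorm (G *m v)) ^+ 2)).
  by rewrite -expr2 lerXn2r ?nnegrE ?mulr_ge0 ?enorm_ge0 ?sqr_ge0.
have -> : rho * enorm z ^+ 2 * enorm v ^+ 2 =
  enorm z ^+ 2 * (rho * enorm v ^+ 2) by ring.
rewrite exprMn.
by rewrite ler_wpM2l ?sqr_ge0// hG.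
Qed.

End EuclideanNorm.

(** * Decomposition of stacked vectors into feature blocks *)

Section Coefficients.
Context {R : realType} {T M : nat}.
Implicit Types (b : stacked R T M) (J : {set 'I_M}) (j : 'I_M).

Lemma dot_stacked m (u v : stacked R T m) :
  dot u v = \sum_(t < T) dot (submxcol u t) (submxcol v t).
Proof.
rewrite /dot -[in LHS](submxcolK u) -[in LHS](submxcolK v).
rewrite [RHS]sig_big_dep/= (reindex _ tagnat.sig_bij_on)/=.
by apply: eq_bigr => l _; rewrite !mxE.
Qed.

Lemma dot_feature b c : dot b c = \sum_j dot (feature b j) (feature c j).
Proof.
rewrite dot_stacked /dot exchange_big/=; apply: eq_bigr => j _.
by apply: eq_bigr => t _; rewrite !mxE.
Qed.

Lemma featureD b c j : feature (b + c) j = feature b j + feature c j.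
Proof. by apply/matrixP => t i; rewrite !mxE. Qed.

Lemma featureN b j : feature (- b) j = - feature b j.
Proof. by apply/matrixP => t i; rewrite !mxE. Qed.

Lemma featureZ (a : R) b j : feature (a *: b) j = a *: feature b j.
Proof. by apply/matrixP => t i; rewrite !mxE. Qed.

Lemma feature_restr J b j :
  feature (restr J b) j = if j \in J then feature b j else 0.
Proof.
apply/matrixP => t i; rewrite mxE /task /restr mxcolK mxE.
by case: ifP => _; rewrite !mxE.
Qed.

Lemma norm21_restr J b : norm21 (restr J b) = \sum_(j in J) enorm (feature b j).
Proof.
rewrite [RHS]big_mkcond; apply: eq_bigr => j _.
by rewrite feature_restr; case: ifP; rewrite ?enorm0.
Qed.

Lemma sqr_enorm_restr J b :
  enorm (restr J b) ^+ 2 = \sum_(j in J) enorm (feature b j) ^+ 2.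
Proof.
rewrite sqr_enorm dot_feature [RHS]big_mkcond; apply: eq_bigr => j _.
by rewrite -sqr_enorm feature_restr; case: ifP; rewrite ?enorm0 ?expr0n.
Qed.

Lemma sqr_enorm_feature b : enorm b ^+ 2 = \sum_j enorm (feature b j) ^+ 2.
Proof. by rewrite sqr_enorm dot_feature; under eq_bigr do rewrite -sqr_enorm. Qed.

Lemma norm21_ge0 b : 0 <= norm21 b.
Proof. by apply: sumr_ge0 => j _; exact: enorm_ge0. Qed.

Lemma norm21D b c : norm21 (b + c) <= norm21 b + norm21 c.
Proof.
by rewrite -big_split; apply: ler_sum => j _; rewrite featureD enormD.
Qed.

Lemma norm21_split J b :
  norm21 b = norm21 (restr J b) + norm21 (restr (~: J)%SET b).
Proof.
rewrite !norm21_restr /norm21 (bigID (mem J))/=; congr (_ + _).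
by apply: eq_bigl => j; rewrite finset.in_setC.
Qed.

Lemma sqr_enorm_split J b :
  enorm b ^+ 2 = enorm (restr J b) ^+ 2 + enorm (restr (~: J)%SET b) ^+ 2.
Proof.
rewrite !sqr_enorm_restr sqr_enorm_feature (bigID (mem J))/=; congr (_ + _).
by apply: eq_bigl => j; rewrite finset.in_setC.
Qed.

(** Cauchy-Schwarz against the indicator vector [u] of [K], used for both [u] and [- u] because the
    sum may be negative. *)
Lemma sum_sqr_le_card (K : {set 'I_M}) (f : 'I_M -> R) :
  (\sum_(j in K) f j) ^+ 2 <= #|K|%:R * \sum_(j in K) f j ^+ 2.
Proof.
pose u : 'cV[R]_M := \col_j (if j \in K then 1 else 0).
pose v : 'cV[R]_M := \col_j (if j \in K then f j else 0).
have uv : dot u v = \sum_(j in K) f j.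
  rewrite [RHS]big_mkcond; apply: eq_bigr => j _; rewrite !mxE.
  by case: ifP; rewrite ?mul1r ?mul0r.
have uu : dot u u = #|K|%:R.
  rewrite -sum1_card natr_sum [RHS]big_mkcond; apply: eq_bigr => j _; rewrite !mxE.
  by case: ifP; rewrite ?mul1r ?mul0r.
have vv : dot v v = \sum_(j in K) f j ^+ 2.
  rewrite [RHS]big_mkcond; apply: eq_bigr => j _; rewrite !mxE.
  by case: ifP; rewrite ?mulr0 ?expr2.
rewrite -uv -uu -vv -!sqr_enorm -exprMn.
have := cauchy_schwarz u v; have := cauchy_schwarz (- u) v.
rewrite enormN dotNl => h1 h2.
rewrite -ler_sqrt ?sqr_ge0// !sqrtr_sqr.
rewrite [X in _ <= X]ger0_norm ?mulr_ge0 ?enorm_ge0// ler_norml h2 andbT.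
by rewrite lerNl.
Qed.

Lemma norm21_restr_le J b (s : nat) : (#|J| <= s)%N ->
  norm21 (restr J b) <= Num.sqrt s%:R * enorm (restr J b).
Proof.
move=> Js; rewrite -[leLHS]ger0_norm ?norm21_ge0// -sqrtr_sqr.
rewrite -[X in _ * X]ger0_norm ?enorm_ge0// -(sqrtr_sqr (enorm _)).
rewrite -sqrtrM ?ler0n// ler_wsqrtr// norm21_restr sqr_enorm_restr.
apply: le_trans (sum_sqr_le_card _ _) _.
rewrite ler_wpM2r ?ler_nat//; apply: sumr_ge0 => j _; exact: sqr_ge0.
Qed.

End Coefficients.

(** * Oracle inequalities *)

(** This is the limit as [e] tends to 0. It extracts first-order conditions from extremality along a
    segment, both for the penalised objective and for the Rayleigh quotient. *)
Lemma ler_add_small_multiples (R : realFieldType) (x y z : R) :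
  (forall e, 0 < e -> e <= 1 -> x <= y + e * z) -> x <= y.
Proof.
move=> h; rewrite leNgt; apply/negP => yx.
have z0 : 0 < `|z| + (x - y) + 1 by have := normr_ge0 z; lra.
(* The denominator ensures both [e <= 1] and [e * z <= (x - y) / 2], which contradicts the
   hypothesis. *)
pose e := (x - y) / (`|z| + (x - y) + 1) / 2.
have e0 : 0 < e by rewrite !divr_gt0// subr_gt0.
have eE : e * (`|z| + (x - y) + 1) = (x - y) / 2.
  by rewrite /e; field; rewrite gt_eqF.
have e1 : e <= 1.
  rewrite -(ler_pM2r z0) eE; have := normr_ge0 z; lra.
have := h e e0 e1; have : e * z <= e * `|z| by rewrite ler_pM2l// ler_norm.
have : 0 <= e * (x - y) by rewrite mulr_ge0 ?subr_ge0 ?ltW.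
lra.
Qed.

(** Greedy selection: each step adds a maximiser of [f] on what is left of [K]. If nothing is left,
    the set stays as it is, whence only an upper bound on its size. *)
Lemma exists_largest (R : realFieldType) (I : finType) (f : I -> R)
    (K : {set I}) (s : nat) :
  exists J : {set I}, [/\ J \subset K, (#|J| <= s)%N &
    forall j, j \in K :\: J -> s%:R * f j <= \sum_(i in J) f i].
Proof.
elim: s => [|s [J [JK Js Jf]]].
  exists finset.set0; split; rewrite ?finset.sub0set ?cards0// => j _.
  by rewrite mul0r big_set0.
have [KJ|[i0 i0K]] := set_0Vmem (K :\: J).
  by exists J; split => [//||j]; [exact: leqW|rewrite KJ finset.in_set0].
case: (@arg_maxP _ _ _ i0 (fun i => i \in K :\: J) f i0K) => i iK fi.
have /setDP[iK' iJ] := iK.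
exists (i |: J)%SET; split.
- by rewrite finset.subUset finset.sub1set iK' JK.
- by rewrite cardsU1 iJ.
- move=> j; rewrite !inE negb_or -andbA => /and3P[ji jJ jK].
  have jKJ : j \in K :\: J by rewrite inE jJ.
  rewrite big_setU1//= -natr1 mulrDl mul1r addrC lerD ?Jf//.
  exact: fi.
Qed.

(** * Deterministic bounds when the noise is small *)

Section Oracle.
Context {R : realType} {T M p : nat}.
Variables (G : 'M[R]_(p, (\sum_(t < T) M)%N)) (bs bh : stacked R T M).
Variables (w : 'cV[R]_p) (c lambda : R).
Hypotheses (c0 : 0 < c) (lambda0 : 0 < lambda).

Let obj (b : stacked R T M) :=
  c * enorm (G *m b - (G *m bs + w)) ^+ 2 + 2 * lambda * norm21 b.

Hypothesis bh_min : forall b, obj bh <= obj b.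
Hypothesis noise : forall j, c * enorm (feature (G^T *m w) j) <= lambda / 2.

Let d := bh - bs.

Let residual : G *m bh - (G *m bs + w) = G *m d - w.
Proof. by rewrite mulmxBr opprD addrA. Qed.

(** Optimality against [bs] leaves the cross term of [G *m d] and [w]. Moving [G] to the other side
    and applying Cauchy-Schwarz in each block bounds it through [noise]. *)
Lemma basic_inequality :
  c * enorm (G *m d) ^+ 2 + lambda * norm21 d <=
  2 * lambda * (norm21 d + norm21 bs - norm21 bh).
Proof.
have := bh_min bs; rewrite /obj residual.
have -> : G *m bs - (G *m bs + w) = - w by rewrite opprD addrA subrr add0r.
rewrite enormN sqr_enormB => h.
suff : c * dot (G *m d) w <= lambda / 2 * norm21 d by move: h; lra.
rewrite dotC dot_mulmx dot_feature !mulr_sumr; apply: ler_sum => j _.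
apply: (@le_trans _ _ (c * (enorm (feature (G^T *m w) j) * enorm (feature d j)))).
  by rewrite ler_pM2l// cauchy_schwarz.
by rewrite mulrA ler_wpM2r ?enorm_ge0.
Qed.

Lemma slow_rate : c * enorm (G *m d) ^+ 2 <= 4 * lambda * norm21 bs.
Proof.
have := basic_inequality.
have dle : norm21 d <= norm21 bh + norm21 bs.
  rewrite /d; apply: le_trans (norm21D _ _) _; rewrite lerD2l.
  by apply: ler_sum => j _; rewrite featureN enormN.
have : lambda * norm21 d <= lambda * (norm21 bh + norm21 bs) by rewrite ler_pM2l.
have : 0 <= lambda * norm21 bh by rewrite mulr_ge0 ?norm21_ge0 ?ltW.
have : 0 <= lambda * norm21 bs by rewrite mulr_ge0 ?norm21_ge0 ?ltW.
lra.
Qed.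

(** The right side of [basic_inequality] is a sum over blocks. Off the support of [bs] the blocks of
    [d] and [bh] coincide and cancel; on it the triangle inequality leaves twice the block of
    [d]. *)
Lemma cone_inequality :
  c * enorm (G *m d) ^+ 2 + lambda * norm21 d <=
  4 * lambda * norm21 (restr (supp bs) d).
Proof.
apply: le_trans basic_inequality _.
have -> : 4 * lambda * norm21 (restr (supp bs) d) =
  2 * lambda * (2 * norm21 (restr (supp bs) d)) by ring.
rewrite ler_pM2l ?mulr_gt0//.
rewrite norm21_restr mulr_sumr [leRHS]big_mkcond /norm21 -sumrN -!big_split/=.
apply: ler_sum => j _; rewrite inE.
have bhE : feature bh j = feature d j + feature bs j.
  by rewrite -featureD subrK.
case: eqP => /= [b0|_].
  by rewrite bhE b0 addr0 enorm0; lra.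
have : feature bs j = feature bh j + - feature d j by rewrite bhE addrC addKr.
have := enormD (feature bh j) (- feature d j); rewrite enormN => h1 h2.
by move: h1; rewrite -h2; lra.
Qed.

(** On an active block the gradient of the fit must balance the penalty, so its norm is at least
    [lambda]; the noise accounts for at most half of this. *)
Lemma stationarity j : j \in supp bh ->
  lambda / 2 <= c * enorm (feature (G^T *m (G *m d)) j).
Proof.
rewrite inE -enorm_eq0 => bhj.
have a0 : 0 < enorm (feature bh j) by rewrite lt_def bhj enorm_ge0.
set a := enorm (feature bh j) in a0.
(* Compare [bh] with the vectors whose [j]-th block is shrunk by [1 - e]. *)
pose b := restr [set j]%SET bh.
pose r := G *m d - w.
have shrink e : 0 <= e -> e <= 1 -> norm21 (bh - e *: b) = norm21 bh - e * a.
  move=> e0 e1; rewrite /norm21 (bigD1 j)//= [in RHS](bigD1 j)//=.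
  rewrite featureD featureN featureZ feature_restr finset.in_set1 eqxx.
  rewrite -{1}[feature bh j]scale1r -scalerBl enormZ ?subr_ge0//.
  rewrite (eq_bigr (fun i => enorm (feature bh i))) => [|i /negbTE ij].
    by rewrite /a; ring.
  rewrite featureD featureN featureZ feature_restr finset.in_set1 ij.
    by rewrite scaler0 subr0.
(* The optimality inequality is divided by [2 * e]; the remaining quadratic term vanishes as [e]
   tends to 0. *)
have key : lambda * a <= - (c * dot r (G *m b)).
  apply: (@ler_add_small_multiples _ _ _ (c / 2 * enorm (G *m b) ^+ 2)) => e e0 e1.
  pose b' := bh - e *: b.
  have Gb' : G *m b' - (G *m bs + w) = r - e *: (G *m b).
    by rewrite /r -residual /b' mulmxBr -scalemxAr addrAC.
  have := bh_min b'; rewrite /obj residual -/r Gb' {1}/b' shrink ?(ltW e0)//.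
  rewrite (sqr_enormB r) dotZr (enormZ _ (ltW e0)) => h.
  by rewrite -(ler_pM2l e0); lra.
have gr : feature (G^T *m r) j =
    feature (G^T *m (G *m d)) j + - feature (G^T *m w) j.
  by rewrite /r mulmxBr featureD featureN.
have dotb : dot r (G *m b) = dot (feature (G^T *m r) j) (feature bh j).
  rewrite dot_mulmx dot_feature (bigD1 j)//= feature_restr finset.in_set1 eqxx.
  rewrite [X in _ + X]big1 ?addr0// => i /negbTE ij.
  by rewrite feature_restr finset.in_set1 ij dotC dot0l.
have := cauchy_schwarz (- feature (G^T *m r) j) (feature bh j).
rewrite dotNl enormN -dotb -/a => cs.
have gle : enorm (feature (G^T *m r) j) <=
    enorm (feature (G^T *m (G *m d)) j) + enorm (feature (G^T *m w) j).
  by rewrite gr; apply: le_trans (enormD _ _) _; rewrite enormN.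
have : lambda <= c * enorm (feature (G^T *m r) j).
  rewrite -(ler_pM2r a0); apply: le_trans key _.
  by rewrite -mulrN -mulrA ler_pM2l.
have := noise j.
have : c * enorm (feature (G^T *m r) j) <=
    c * (enorm (feature (G^T *m (G *m d)) j) + enorm (feature (G^T *m w) j)).
  by rewrite ler_pM2l.
lra.
Qed.

(** By [stationarity] each active block contributes at least [(lambda / 2) ^+ 2] to
    [c ^+ 2 * enorm v ^+ 2], and the operator bound for the transpose controls the total. *)
Lemma sparsity_bound (rho : R) : 0 <= rho ->
    (forall v, enorm (G *m v) ^+ 2 <= rho * enorm v ^+ 2) ->
  #|supp bh|%:R * lambda ^+ 2 <= 4 * c ^+ 2 * (rho * enorm (G *m d) ^+ 2).
Proof.
move=> rho0 hG.
have := enorm_tr_mulmx rho0 hG (G *m d).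
set v := G^T *m (G *m d) => hv.
have : #|supp bh|%:R * (lambda / 2) ^+ 2 <= c ^+ 2 * enorm v ^+ 2.
  rewrite sqr_enorm_feature (bigID (mem (supp bh)))/= mulrDr ler_wpDr//.
    by rewrite mulr_ge0 ?sqr_ge0// sumr_ge0// => j _; rewrite sqr_ge0.
  rewrite -sum1_card natr_sum mulr_suml mulr_sumr; apply: ler_sum => j jS.
  have l2 : 0 <= lambda / 2 by rewrite divr_ge0 ?ltW.
  rewrite mul1r -exprMn lerXn2r ?nnegrE ?stationarity//.
  by rewrite mulr_ge0 ?enorm_ge0 ?ltW.
have : c ^+ 2 * enorm v ^+ 2 <= c ^+ 2 * (rho * enorm (G *m d) ^+ 2).
  by rewrite ler_wpM2l ?sqr_ge0.
lra.
Qed.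

(** Division-free form of the assumption, valid also at [D = 0]; the factor [Num.sqrt n%:R] is
    absorbed into [k]. *)
Definition restricted_eigenvalue (s : nat) (k : R) :=
  forall (J : {set 'I_M}) (D : stacked R T M), (#|J| <= s)%N ->
    norm21 (restr (~: J)%SET D) <= 3 * norm21 (restr J D) ->
    k * enorm (restr J D) <= enorm (G *m D).

Variables (s : nat) (k : R).
Hypotheses (k0 : 0 < k) (supp_s : (#|supp bs| <= s)%N).

Let J := supp bs.

Lemma cone : norm21 (restr (~: J)%SET d) <= 3 * norm21 (restr J d).
Proof.
have := cone_inequality; rewrite (norm21_split J d) -/J => h.
have g0 : 0 <= c * enorm (G *m d) ^+ 2 by rewrite mulr_ge0 ?sqr_ge0 ?ltW.
by rewrite -(ler_pM2l lambda0); lra.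
Qed.

(** The cone inequality is quadratic in the fit on the left and linear in the norm over [K] on the
    right, so bounding the latter by the fit cancels one power. The set [K] is left free to allow
    both the support and its enlargement to [2 * s] blocks, while the factor [Num.sqrt s%:R] comes
    from [J] alone. *)
Lemma fit_restr_bound (K : {set 'I_M}) : J \subset K ->
    k * enorm (restr K d) <= enorm (G *m d) ->
  c * k * enorm (G *m d) <= 4 * lambda * Num.sqrt s%:R.
Proof.
move=> JK hk; set g := enorm (G *m d); set x := enorm (restr K d).
have Jx : enorm (restr J d) <= x.
  rewrite -(@ler_pXn2r _ 2) ?nnegrE ?enorm_ge0// !sqr_enorm_restr.
  rewrite [leRHS](big_setID J)/= (finset.setIidPr JK) lerDl.
  by apply: sumr_ge0 => j _; exact: sqr_ge0.
have h1 := norm21_restr_le d supp_s.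
have h2 := cone_inequality.
have h3 : c * g ^+ 2 <= 4 * lambda * (Num.sqrt s%:R * x).
  have dn : 0 <= lambda * norm21 d by rewrite mulr_ge0 ?norm21_ge0 ?ltW.
  have : 4 * lambda * norm21 (restr J d) <= 4 * lambda * (Num.sqrt s%:R * x).
    rewrite ler_pM2l ?mulr_gt0//; apply: le_trans h1 _.
    by rewrite ler_wpM2l ?sqrtr_ge0.
  by move: h2; rewrite -/g -/J; lra.
have [g0|g0] := eqVneq g 0.
  by rewrite g0 mulr0 !mulr_ge0 ?sqrtr_ge0 ?ltW.
have gp : 0 < g by rewrite lt_def g0 enorm_ge0.
rewrite -(ler_pM2r gp).
apply: (@le_trans _ _ (k * (4 * lambda * (Num.sqrt s%:R * x)))).
  have -> : c * k * g * g = k * (c * g ^+ 2) by ring.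
  by rewrite ler_pM2l.
have -> : k * (4 * lambda * (Num.sqrt s%:R * x)) =
  4 * lambda * Num.sqrt s%:R * (k * x) by ring.
by rewrite ler_wpM2l// !mulr_ge0 ?sqrtr_ge0 ?ltW.
Qed.

Lemma fast_rate : restricted_eigenvalue s k ->
  c * enorm (G *m d) ^+ 2 <= 16 * lambda ^+ 2 * s%:R / (c * k ^+ 2).
Proof.
move=> re; have := fit_restr_bound (subxx J) (re J d supp_s cone).
set g := enorm (G *m d) => h.
have ck : 0 < c * k ^+ 2 by rewrite mulr_gt0 ?exprn_gt0.
rewrite ler_pdivlMr//.
have -> : c * g ^+ 2 * (c * k ^+ 2) = (c * k * g) ^+ 2 by ring.
have -> : 16 * lambda ^+ 2 * s%:R = (4 * lambda * Num.sqrt s%:R) ^+ 2.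
  by rewrite !exprMn sqr_sqrtr ?ler0n//; ring.
by rewrite lerXn2r ?nnegrE ?mulr_ge0 ?sqrtr_ge0 ?enorm_ge0 ?(ltW c0) ?(ltW k0)
  ?(ltW lambda0).
Qed.

(** The cone gives a factor 4 in passing from [d] to its restriction to [J], and [fit_restr_bound]
    gives the other 4. *)
Lemma norm21_rate : restricted_eigenvalue s k ->
  norm21 d <= 16 * lambda * s%:R / (c * k ^+ 2).
Proof.
move=> re; have hk := re J d supp_s cone.
have h := fit_restr_bound (subxx J) hk.
have ck : 0 < c * k ^+ 2 by rewrite mulr_gt0 ?exprn_gt0.
rewrite ler_pdivlMr//.
have h1 := norm21_restr_le d supp_s; rewrite -/J in h1.
have h4 : norm21 d <= 4 * (Num.sqrt s%:R * enorm (restr J d)).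
  by have := cone; rewrite (norm21_split J d); move: h1; lra.
apply: (@le_trans _ _
    (4 * (Num.sqrt s%:R * enorm (restr J d)) * (c * k ^+ 2))).
  by rewrite ler_pM2r.
have -> : 4 * (Num.sqrt s%:R * enorm (restr J d)) * (c * k ^+ 2) =
  4 * Num.sqrt s%:R * (c * k * (k * enorm (restr J d))) by ring.
have -> : 16 * lambda * s%:R =
    4 * Num.sqrt s%:R * (4 * lambda * Num.sqrt s%:R).
  by rewrite -[in LHS](sqr_sqrtr (ler0n R s)); ring.
rewrite ler_wpM2l ?mulr_ge0 ?sqrtr_ge0//; apply: le_trans h.
by rewrite ler_pM2l ?mulr_gt0.
Qed.

(* Off the union of [J] and the [s] largest blocks outside [J], every block
   norm is at most [1/s] times the (2,1)-norm over those [s] blocks. *)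
Lemma enorm_rate : (0 < s)%N -> restricted_eigenvalue (2 * s) k ->
  enorm d <= 4 * Num.sqrt 10 * lambda * Num.sqrt s%:R / (c * k ^+ 2).
Proof.
move=> s0 re.
pose f j := enorm (feature d j).
have [J0 [J0J J0s J0f]] := exists_largest f (~: J)%SET s.
pose K := (J :|: J0)%SET.
have JK : J \subset K by exact: finset.subsetUl.
have KJ0 : (~: K = (~: J) :\: J0)%SET by rewrite finset.setCU finset.setDE.
have f0 j : 0 <= f j by exact: enorm_ge0.
have Ks : (#|K| <= 2 * s)%N.
  by rewrite (leq_trans (leq_card_setU _ _))// mul2n -addnn leq_add.
have splitJc : norm21 (restr (~: J)%SET d) =
    \sum_(j in J0) f j + \sum_(j in ~: K) f j.
  by rewrite norm21_restr (big_setID J0)/= (finset.setIidPr J0J) KJ0.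
have normK : norm21 (restr K d) = norm21 (restr J d) + \sum_(j in J0) f j.
  rewrite !norm21_restr (big_setID J)/= (finset.setIidPr JK); congr (_ + _).
  rewrite finset.setDUl finset.setDv finset.set0U.
  apply: eq_bigl => j; rewrite !inE andbC.
  case: (boolP (j \in J0)) => //= jJ0.
  by have := fintype.subsetP J0J _ jJ0; rewrite !inE.
have S0 : 0 <= \sum_(j in J0) f j by exact: sumr_ge0.
have SK : 0 <= \sum_(j in ~: K) f j by exact: sumr_ge0.
have coneK : norm21 (restr (~: K)%SET d) <= 3 * norm21 (restr K d).
  have -> : norm21 (restr (~: K)%SET d) = \sum_(j in ~: K) f j.
    exact: norm21_restr.
  by have := cone; rewrite splitJc normK; move: S0 SK; lra.
have hk := re K d Ks coneK.
have h := fit_restr_bound JK hk.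
have s0' : 0 < s%:R :> R by rewrite ltr0n.
(* By the choice of [J0] the left side is at most the product of the sums of [f] over [J0] and over
   [~: K], hence at most the square of their total. *)
have tailK : s%:R * enorm (restr (~: K)%SET d) ^+ 2 <=
    norm21 (restr (~: J)%SET d) ^+ 2.
  rewrite sqr_enorm_restr mulr_sumr.
  apply: (@le_trans _ _ (\sum_(j in ~: K) (\sum_(i in J0) f i) * f j)).
    apply: ler_sum => j; rewrite KJ0 => jK; rewrite expr2 mulrA.
    by apply: ler_wpM2r; [exact: f0|exact: J0f].
  by rewrite -mulr_sumr splitJc; nra.
(* The 9 is the square of the cone constant; the factor [s] of [tailK] cancels against the one lost
   between the two norms on [J]. *)
have tail9 : enorm (restr (~: K)%SET d) ^+ 2 <= 9 * enorm (restr K d) ^+ 2.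
  rewrite -(ler_pM2l s0'); apply: le_trans tailK _.
  apply: (@le_trans _ _ ((3 * norm21 (restr J d)) ^+ 2)).
    by rewrite lerXn2r ?nnegrE ?mulr_ge0 ?norm21_ge0// cone.
  have -> : s%:R * (9 * enorm (restr K d) ^+ 2) =
      (3 * (Num.sqrt s%:R * enorm (restr K d))) ^+ 2.
    by rewrite !exprMn (sqr_sqrtr (ltW s0')); ring.
  rewrite lerXn2r ?nnegrE ?mulr_ge0 ?norm21_ge0 ?enorm_ge0 ?sqrtr_ge0//.
  rewrite ler_pM2l//; apply: le_trans (norm21_restr_le d supp_s) _.
  rewrite ler_wpM2l ?sqrtr_ge0//.
  rewrite -(@ler_pXn2r _ 2) ?nnegrE ?enorm_ge0// !sqr_enorm_restr.
  rewrite [leRHS](big_setID J)/= (finset.setIidPr JK) lerDl.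
  by apply: sumr_ge0 => j _; exact: sqr_ge0.
(* Here 10 is 1 for the part on [K] plus 9 for the tail. *)
have dK : enorm d <= Num.sqrt 10 * enorm (restr K d).
  rewrite -(@ler_pXn2r _ 2) ?nnegrE ?mulr_ge0 ?sqrtr_ge0 ?enorm_ge0//.
  by rewrite exprMn (@sqr_sqrtr _ 10)// (sqr_enorm_split K); move: tail9; lra.
have ck : 0 < c * k ^+ 2 by rewrite mulr_gt0 ?exprn_gt0.
rewrite ler_pdivlMr//.
apply: (@le_trans _ _ (Num.sqrt 10 * enorm (restr K d) * (c * k ^+ 2))).
  by rewrite ler_pM2r.
have -> : Num.sqrt 10 * enorm (restr K d) * (c * k ^+ 2) =
  Num.sqrt 10 * (c * k * (k * enorm (restr K d))) by ring.
have -> : 4 * Num.sqrt 10 * lambda * Num.sqrt s%:R =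
  Num.sqrt 10 * (4 * lambda * Num.sqrt s%:R) by ring.
rewrite ler_wpM2l ?sqrtr_ge0//; apply: le_trans h.
by rewrite ler_pM2l ?mulr_gt0.
Qed.

End Oracle.

(** * Largest eigenvalue *)

Section RayleighQuotient.
Context {R : realType} (k : nat).
Implicit Types (S : 'M[R]_k) (x y u : 'cV[R]_k).

Lemma continuous_dot_rV S :
  continuous (fun v : 'rV[R]_k => dot v^T (S *m v^T)).
Proof.
have E : (fun v : 'rV[R]_k => dot v^T (S *m v^T)) =
    (fun v => \sum_i v 0 i * \sum_j S i j * v 0 j).
  apply/funext => v; apply: eq_bigr => i _; rewrite !mxE; congr (_ * _).
  by apply: eq_bigr => j _; rewrite mxE.
rewrite E.
apply: continuous_big => [|i _ v]; first exact: add_continuous.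
apply: (@cvgM _ _ (nbhs v)); first exact: coord_continuous.
apply: (@cvg_big _ _ _ _ _ _ _ (nbhs v)) => [|j _]; first exact: add_continuous.
by apply: (@cvgM _ _ (nbhs v)); [exact: cvg_cst|exact: coord_continuous].
Qed.

(** A continuous function attains its maximum on the compact unit sphere, and homogeneity extends
    the bound to all vectors. The vector [x] witnesses that the sphere is nonempty. *)
Lemma rayleigh_max S x : x != 0 ->
  exists u, dot u u = 1 /\
    forall y, dot y (S *m y) <= dot u (S *m u) * dot y y.
Proof.
move=> x0.
(* The identity matrix makes the squared norm a case of [continuous_dot_rV], which then yields
   closedness of the sphere. *)
pose A := [set v : 'rV[R]_k | dot v^T (1%:M *m v^T) = 1].
have normalize y : y != 0 -> A ((enorm y)^-1 *: y)^T.
  move=> y0; rewrite /A/= trmxK mul1mx dotZl dotZr -sqr_enorm.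
  by field; rewrite enorm_eq0.
have box_compact : compact
    [set v : 'rV[R]_k | forall i, v ord0 i \in `[(- 1), 1]].
  apply: (@rV_compact R k (fun=> `[(- 1), 1]%classic)) => i.
  exact: segment_compact.
have A_closed : closed A.
  apply: (@closed_comp _ _ (fun v : 'rV[R]_k => dot v^T (1%:M *m v^T)) [set 1]).
    by move=> v _; exact: continuous_dot_rV.
  exact: closed_eq.
have cA : compact A.
  apply: subclosed_compact A_closed box_compact _.
  move=> v /= v1 i; rewrite in_itv/= -ler_norml.
  rewrite -(@ler_pXn2r _ 2) ?nnegrE// expr1n -v1 mul1mx /dot (bigD1 i)//= !mxE.
  rewrite -normrX ger0_norm ?sqr_ge0// expr2 lerDl.
  by apply: sumr_ge0 => j _; rewrite -expr2 sqr_ge0.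
have [v /set_mem v1 vmax] := EVT_max_rV (ex_intro A _ (normalize x x0)) cA
  (continuous_subspaceT (@continuous_dot_rV S)).
exists v^T; split; first by move: v1; rewrite /A/= mul1mx.
move=> y; have [->|y0] := eqVneq y 0.
  by rewrite !dot0l mulr0.
have := vmax _ (mem_set (normalize y y0)).
rewrite trmxK -scalemxAr dotZl dotZr mulrA -expr2 exprVn => h.
have y2 : 0 < enorm y ^+ 2.
  by rewrite exprn_gt0// lt_def enorm_eq0 y0 enorm_ge0.
by rewrite -sqr_enorm -ler_pdivrMr// mulrC.
Qed.

(** The maximum [rho] of the Rayleigh quotient is itself an eigenvalue, hence at most [phi]:
    perturbing the maximiser [u] along the residual [r] forces [r] to vanish. By symmetry the
    transpose of [u] is then the row eigenvector that [eigenvalue] asks for. *)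
Lemma rayleigh_bound S phi x : S^T = S -> largest_eigenvalue S phi ->
  dot x (S *m x) <= phi * dot x x.
Proof.
move=> symS [_ phi_max].
have [->|x0] := eqVneq x 0; first by rewrite !dot0l mulr0.
have [u [u1 umax]] := rayleigh_max S x0.
set rho := dot u (S *m u) in umax.
apply: le_trans (umax x) _; rewrite ler_wpM2r//.
  by rewrite -sqr_enorm sqr_ge0.
apply: phi_max; apply/eigenvalueP.
exists u^T; last first.
  rewrite -trmx_eq0 trmxK; apply/eqP => u0; move: u1; rewrite u0 dot0l => /esym/eqP.
  by rewrite oner_eq0.
rewrite -[u^T *m S]trmxK trmx_mul trmxK symS -linearZ; congr (_^T).
apply/eqP; rewrite -subr_eq0.
have [r rE] : exists r, r = S *m u - rho *: u by eexists.
rewrite -rE.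
have ru : dot r (S *m u) = dot u (S *m r) by rewrite [RHS]dot_mulmx symS dotC.
rewrite -enorm_eq0 -sqrf_eq0 sqr_enorm eq_le; apply/andP; split; last first.
  by rewrite -sqr_enorm sqr_ge0.
apply: (@ler_add_small_multiples _ _ _
  ((rho * dot r r - dot r (S *m r)) / 2)) => e e0 e1.
have := umax (u + e *: r).
rewrite mulmxDr -scalemxAr !(dotDl, dotDr, dotZl, dotZr) -/rho u1 -ru => h.
have rr : dot r r = dot r (S *m u) - rho * dot r u.
  by rewrite {2}rE dotDr dotNr dotZr.
rewrite -(ler_pM2l e0) rr; move: h; rewrite (dotC u r); move: rr.
set p := dot r (S *m u); set q := dot r u; set z := dot r (S *m r).
by move=> ->; lra.
Qed.

End RayleighQuotient.

(** * The multi-task model *)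

Section BlockDiagonal.
Context {R : realType} {T n M : nat}.
Implicit Types (X : 'I_T -> 'M[R]_(n, M)).

Lemma submxcol_blockdiag X (b : stacked R T M) (t : 'I_T) :
  submxcol (blockdiag X *m b) t = X t *m task b t.
Proof.
rewrite -[b in LHS](submxcolK b) /blockdiag mul_mxblock_mxrow mxcolK.
rewrite (bigD1 t)//= eqxx big1 ?addr0// => u /negbTE ut.
by rewrite eq_sym ut mul0mx.
Qed.

Lemma tr_blockdiag X : (blockdiag X)^T = blockdiag (fun t => (X t)^T).
Proof.
rewrite /blockdiag tr_mxblock; apply: eq_mxblock => t u.
by rewrite eq_sym; case: eqP => [->//|_]; rewrite trmx0.
Qed.

End BlockDiagonal.

Section Design.
Context {R : realType} {T n M : nat}.
Implicit Types (X : 'I_T -> 'M[R]_(n, M)).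

(** The index [tagnat.Rank t j] is the position of coordinate [j] of task [t]; a unit diagonal thus
    normalises every column of every [X t]. *)
Lemma gram_diag X (t : 'I_T) (j : 'I_M) :
  gram X (tagnat.Rank t j) (tagnat.Rank t j) = n%:R^-1 * \sum_i X t i j ^+ 2.
Proof.
rewrite mxE; congr (_ * _).
transitivity (submxblock ((blockdiag X)^T *m blockdiag X) t t j j).
  by rewrite [RHS]mxE.
rewrite tr_blockdiag /blockdiag mul_mxblock mxblockK.
rewrite (bigD1 t)//= eqxx big1 ?addr0 => [|u /negbTE ut]; last first.
  by rewrite ut mulmx0.
by rewrite mxE; apply: eq_bigr => i _; rewrite mxE expr2.
Qed.

Lemma objectiveE X (y : 'I_T -> 'cV[R]_n) (lambda : R) (b : stacked R T M) :
  objective X y lambda b =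
  (n%:R * T%:R)^-1 * enorm (blockdiag X *m b - \mxcol_t y t) ^+ 2 +
  2 * lambda * norm21 b.
Proof.
rewrite /objective; congr (_ + _).
  rewrite sqr_enorm dot_stacked -mulr_sumr invfM mulrCA mulrA.
  congr (_ * _); apply: eq_bigr => t _.
  by rewrite submxcolB mxcolK submxcol_blockdiag sqr_enorm.
congr (_ * _); apply: eq_bigr => j _; congr Num.sqrt.
by apply: eq_bigr => t _; rewrite [in RHS]mxE.
Qed.

(** Each entry of a feature block of the noise involves a single task, which is why the entries are
    independent. *)
Lemma feature_tr_blockdiag X (w : 'I_T -> 'cV[R]_n) (j : 'I_M) (t : 'I_T) :
  feature ((blockdiag X)^T *m (\mxcol_u w u : stacked R T n)) j t 0 =
  \sum_i X t i j * w t i 0.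
Proof.
transitivity (submxcol (blockdiag (fun u => (X u)^T) *m
    (\mxcol_u w u : stacked R T n)) t j 0).
  by rewrite -tr_blockdiag [LHS]mxE.
rewrite (submxcol_blockdiag (fun u => (X u)^T)) mxE /task mxcolK.
by apply: eq_bigr => i _; rewrite mxE.
Qed.

Lemma tr_gram X : (gram X)^T = gram X.
Proof. by rewrite /gram linearZ/= trmx_mul trmxK. Qed.

Lemma sqr_enorm_blockdiag_le X (phi : R) (v : stacked R T M) : (0 < n)%N ->
    largest_eigenvalue (gram X) phi ->
  enorm (blockdiag X *m v) ^+ 2 <= n%:R * phi * enorm v ^+ 2.
Proof.
move=> n0 hphi; have n0' : 0 < n%:R :> R by rewrite ltr0n.
have := rayleigh_bound v (tr_gram X) hphi.
rewrite /gram -scalemxAl dotZr -mulmxA dot_mulmx trmxK -!sqr_enorm => h.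
by rewrite -mulrA -ler_pdivrMl.
Qed.

Lemma largest_eigenvalue_ge0 X (phi : R) : (0 < n)%N -> (0 < T)%N -> (0 < M)%N ->
  largest_eigenvalue (gram X) phi -> 0 <= phi.
Proof.
move=> n0 T0 M0 hphi.
pose v : stacked R T M := const_mx 1.
have v0 : 0 < enorm v ^+ 2.
  rewrite exprn_gt0// lt_def enorm_ge0 enorm_eq0 andbT; apply/eqP => v0.
  have := congr1 (fun u : stacked R T M =>
    submxcol u (Ordinal T0) (Ordinal M0) 0) v0.
  by rewrite !mxE => /eqP; rewrite oner_eq0.
have h := le_trans (sqr_ge0 _) (sqr_enorm_blockdiag_le v n0 hphi).
have n0' : 0 < n%:R :> R by rewrite ltr0n.
by move: h; rewrite -mulrA pmulr_rge0// pmulr_lge0.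
Qed.

(** If the restriction to [J] vanishes the bound is trivial; otherwise [D] is nonzero and its ratio
    belongs to [RE_ratios]. *)
Lemma RE_MT_restricted_eigenvalue X (s : nat) (kappa : R) : (0 < n)%N ->
    RE_MT X s kappa ->
  restricted_eigenvalue (blockdiag X) s (kappa * Num.sqrt n%:R).
Proof.
move=> n0 [kappa0 re] J D Js coneD.
have n0' : 0 < Num.sqrt n%:R :> R by rewrite sqrtr_gt0 ltr0n.
have [->|DJ0] := eqVneq (enorm (restr J D)) 0; first by rewrite mulr0 enorm_ge0.
have DJp : 0 < enorm (restr J D) by rewrite lt_def DJ0 enorm_ge0.
have D0 : D <> 0.
  move=> D0; have := sqr_enorm_split J D.
  have -> : enorm D ^+ 2 = 0 by rewrite D0 enorm0 expr0n.
  have := exprn_gt0 2 DJp; have := sqr_ge0 (enorm (restr (~: J)%SET D)); lra.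
have : RE_ratios X s (enorm (blockdiag X *m D) /
    (Num.sqrt n%:R * enorm (restr J D))) by exists J, D.
move=> /re; rewrite ler_pdivlMr ?mulr_gt0//.
by rewrite mulrA.
Qed.

End Design.

(** * Probability of the small-noise event *)

Section NoiseEvent.
Context {R : realType} (d : measure_display) (Omega : measurableType d)
  (P : probability Omega R).

Lemma measure_bigsetU_le (I : Type) (r : seq I) (F : I -> set Omega) :
  (forall i, measurable (F i)) ->
  (P (\big[setU/set0]_(i <- r) F i) <= \sum_(i <- r) P (F i))%E.
Proof.
move=> mF; elim: r => [|i r IH]; first by rewrite !big_nil measure0.
rewrite !big_cons; apply: le_trans (leeD2l _ IH).
by apply: measureU2 => //; apply: bigsetU_measurable.
Qed.

Variables (T n M : nat) (X : 'I_T -> 'M[R]_(n, M)).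
Variables (W : 'I_T -> 'I_n -> {RV P >-> R}) (sigma A : R).
Hypotheses (n0 : (0 < n)%N) (M0 : (0 < M)%N) (sigma0 : 0 < sigma) (A0 : 0 <= A).
Hypothesis indW : mutually_independent (fun ti : 'I_T * 'I_n => W ti.1 ti.2).
Hypothesis nW : forall t i, normally_distributed 0 sigma (W t i).
Hypothesis diagX : forall k, gram X k k = 1.

(** The threshold is the square of [n%:R * T%:R * lambda / 2]. The tail bound with
    [b = 2 * A * ln M%:R] makes each feature fail with probability at most [M%:R] to the power
    [- A / 2], and a union bound multiplies this by [M%:R]. *)
Lemma noise_event : with_prob_at_least P (1 - 2 * M%:R `^ (1 - 2 * A / 5))
  (fun w => forall j, \sum_t (\sum_i X t i j * W t i w) ^+ 2 <=
     n%:R * sigma ^+ 2 * (2 * T%:R + 2 * (A * ln M%:R))).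
Proof.
have n0' : 0 < n%:R :> R by rewrite ltr0n.
have lnM : 0 <= ln M%:R :> R by rewrite ln_ge0// ler1n.
(* This factor gives the entries of the noise blocks unit variance, each column of [X t] having
   squared norm [n%:R]. *)
pose a := (Num.sqrt n%:R * sigma)^-1.
have a2 : a ^+ 2 = (n%:R * sigma ^+ 2)^-1.
  by rewrite /a exprVn exprMn sqr_sqrtr ?ltW.
pose V j t w := \sum_i a * X t i j * W t i w.
pose bad j :=
  [set w | (2 * #|'I_T|%:R + 2 * (A * ln M%:R) < \sum_t V j t w ^+ 2)%R].
have mbad j : measurable (bad j).
  rewrite -[bad j]setTI; apply: measurable_fun_ltr => //.
  by apply: measurable_sum => t; apply: measurable_funX; exact: measurable_lincomb.
have Pbad j : (P (bad j) <= (expR (- (2 * (A * ln M%:R) / 4)))%:E)%E.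
  apply: (chi_square_tail (sigma := sigma)) => //; rewrite ?gt_eqF ?mulr_ge0// => t.
  under eq_bigr do rewrite exprMn.
  rewrite -mulr_sumr a2; have := diagX (tagnat.Rank t j); rewrite gram_diag => h.
  have -> : \sum_i X t i j ^+ 2 = n%:R.
    by apply: (mulfI (invr_neq0 (lt0r_neq0 n0'))); rewrite h mulVf ?gt_eqF.
  by field; rewrite !gt_eqF.
pose U := \big[setU/set0]_(j <- index_enum 'I_M) bad j.
have mU : measurable U by apply: bigsetU_measurable.
have PU : (P U <= (2 * M%:R `^ (1 - 2 * A / 5))%:E)%E.
  apply: le_trans (measure_bigsetU_le _ mbad) _.
  apply: (@le_trans _ _
      (\sum_(j : 'I_M) (expR (- (2 * (A * ln M%:R) / 4)))%:E)%E).
    by apply: lee_sum.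
  rewrite sumEFin lee_fin sumr_const card_ord -[leLHS]mulr_natl.
  have M0' : 0 < M%:R :> R by rewrite ltr0n.
  have ME : M%:R = expR (ln M%:R) :> R by rewrite lnK.
  rewrite {1}ME -expRD /powR gt_eqF//.
  (* The exponent [1 - A / 2] is at most [1 - 2 * A / 5], since [A] and [ln M%:R] are
     nonnegative. *)
  apply: (@le_trans _ _ (expR ((1 - 2 * A / 5) * ln M%:R))).
    by rewrite ler_expR; have := mulr_ge0 A0 lnM; lra.
  by rewrite ler_peMl ?expR_ge0 ?ler1n.
exists (~` U); split.
- exact: measurableC.
- by rewrite probability_setC// EFinB leeB.
- move=> w notU j; rewrite leNgt; apply/negP => badj; apply: notU.
  rewrite /U -bigcup_seq; exists j; first by rewrite /= mem_index_enum.
  rewrite /bad/= card_ord.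
  have -> : \sum_t V j t w ^+ 2 = a ^+ 2 * \sum_t (\sum_i X t i j * W t i w) ^+ 2.
    rewrite mulr_sumr; apply: eq_bigr => t _; rewrite -exprMn; congr (_ ^+ 2).
    by rewrite mulr_sumr; apply: eq_bigr => i _; rewrite mulrA.
  by rewrite a2 ltr_pdivlMl// mulr_gt0 ?exprn_gt0.
Qed.

End NoiseEvent.

(** * Arithmetic of the constants *)

Section Constants.
Context {R : realType} (T n : nat) (sigma L lambda : R).
Hypotheses (T0 : (0 < T)%N) (n0 : (0 < n)%N) (sigma0 : 0 < sigma) (L0 : 0 < L).
Hypothesis lambdaE :
  lambda = 2 * Num.sqrt 2 * sigma / Num.sqrt (n%:R * T%:R) * Num.sqrt L.

Let nR : 0 < n%:R :> R. Proof. by rewrite ltr0n. Qed.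
Let TR : 0 < T%:R :> R. Proof. by rewrite ltr0n. Qed.
Let an : 0 < Num.sqrt n%:R :> R. Proof. by rewrite sqrtr_gt0. Qed.
Let aT : 0 < Num.sqrt T%:R :> R. Proof. by rewrite sqrtr_gt0. Qed.
Let nE : n%:R = Num.sqrt n%:R ^+ 2 :> R. Proof. by rewrite sqr_sqrtr ?ltW. Qed.
Let TE : T%:R = Num.sqrt T%:R ^+ 2 :> R. Proof. by rewrite sqr_sqrtr ?ltW. Qed.

Lemma lambda_gt0 : 0 < lambda.
Proof. by rewrite lambdaE !(mulr_gt0, divr_gt0) ?invr_gt0 ?sqrtr_gt0 ?mulr_gt0. Qed.

Lemma sqr_lambda : lambda ^+ 2 = 8 * sigma ^+ 2 * L / (n%:R * T%:R).
Proof.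
rewrite lambdaE !exprMn exprVn !sqr_sqrtr ?ltW ?mulr_gt0//.
by field; rewrite !gt_eqF.
Qed.

Lemma fast_rate_constant (s kappa : R) : 0 < kappa ->
  16 * lambda ^+ 2 * s / ((n%:R * T%:R)^-1 * (kappa * Num.sqrt n%:R) ^+ 2) =
  128 * sigma ^+ 2 / kappa ^+ 2 * (s / n%:R) * L.
Proof.
move=> k0; rewrite sqr_lambda exprMn sqr_sqrtr ?ltW//.
by field; rewrite !gt_eqF.
Qed.

Lemma norm21_rate_constant (s kappa : R) : 0 < kappa ->
  (Num.sqrt T%:R)^-1 * (16 * lambda * s /
    ((n%:R * T%:R)^-1 * (kappa * Num.sqrt n%:R) ^+ 2)) =
  32 * Num.sqrt 2 * sigma / kappa ^+ 2 * (s / Num.sqrt n%:R) * Num.sqrt L.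
Proof.
move=> k0; rewrite lambdaE sqrtrM ?ltW//; move: nE TE an aT.
set a := Num.sqrt n%:R; set b := Num.sqrt T%:R => -> -> a0 b0.
by field; rewrite !gt_eqF.
Qed.

Lemma enorm_rate_constant (s kappa : R) : 0 <= s -> 0 < kappa ->
  (Num.sqrt T%:R)^-1 * (4 * Num.sqrt 10 * lambda * Num.sqrt s /
    ((n%:R * T%:R)^-1 * (kappa * Num.sqrt n%:R) ^+ 2)) =
  16 * Num.sqrt 5 * sigma / kappa ^+ 2 * Num.sqrt (s / n%:R) * Num.sqrt L.
Proof.
move=> s0 k0.
(* This root of 2 and the one in [lambda] multiply to 2, which turns 8 into 16. *)
have -> : Num.sqrt 10 = Num.sqrt 5 * Num.sqrt 2 :> R.
  by rewrite -sqrtrM//; congr Num.sqrt; ring.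
rewrite lambdaE (sqrtrM T%:R (ltW nR)) (sqrtrM _ s0) sqrtrV ?ltW//.
have h2 : Num.sqrt 2 ^+ 2 = 2 :> R by rewrite sqr_sqrtr.
move: nE TE an aT.
set a := Num.sqrt n%:R; set b := Num.sqrt T%:R => -> -> a0 b0.
have -> : 16 * Num.sqrt 5 * sigma / kappa ^+ 2 * (Num.sqrt s / a) * Num.sqrt L =
  8 * Num.sqrt 2 ^+ 2 * Num.sqrt 5 * sigma / kappa ^+ 2 * (Num.sqrt s / a)
    * Num.sqrt L.
  by rewrite h2; field; rewrite !gt_eqF.
by field; rewrite !gt_eqF.
Qed.

(** The value of [lambda] is tuned to this: after squaring and clearing the factor [n%:R * T%:R],
    the two bounds are equal. *)
Lemma noise_level (V : R) : 0 <= V ->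
    V ^+ 2 <= n%:R * sigma ^+ 2 * (2 * (T%:R * L)) ->
  (n%:R * T%:R)^-1 * V <= lambda / 2.
Proof.
move=> V0 hV; have l0 := lambda_gt0.
rewrite ler_pdivrMl ?mulr_gt0//.
rewrite -(@ler_pXn2r _ 2) ?nnegrE ?mulr_ge0 ?invr_ge0 ?(ltW l0)//.
apply: le_trans hV _.
rewrite !exprMn sqr_lambda le_eqVlt; apply/orP; left; apply/eqP.
by field; rewrite !gt_eqF.
Qed.

End Constants.

Theorem corollary4p1 (R : realType) (d : measure_display)
    (Omega : measurableType d) (P : probability Omega R)
    (T n M : nat) (hT : (1 <= T)%N) (hn : (1 <= n)%N) (hM : (2 <= M)%N)
    (X : 'I_T -> 'M[R]_(n, M)) (betastar : stacked R T M)
    (W : 'I_T -> 'I_n -> {RV P >-> R}) (y : 'I_T -> Omega -> 'cV[R]_n)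
    (hmodel : forall (t : 'I_T) (omega : Omega),
      y t omega = X t *m task betastar t + \col_(i < n) W t i omega)
    (sigma : R) (hsigma : 0 < sigma)
    (hWindep : mutually_independent (fun ti : 'I_T * 'I_n => W ti.1 ti.2))
    (hWnormal : forall (t : 'I_T) (i : 'I_n),
      normally_distributed 0 sigma (W t i))
    (hdiag : forall k, gram X k k = 1)
    (A : R) (hA : 5 / 2 < A) (lambda : R)
    (hlambda : lambda = 2 * Num.sqrt 2 * sigma / Num.sqrt (n%:R * T%:R)
                        * Num.sqrt (1 + A * ln M%:R / T%:R)) :
  with_prob_at_least P (1 - 2 * M%:R `^ (1 - 2 * A / 5)) (fun omega =>
    forall betahat : stacked R T M,
      MT_solution X (y^~ omega) lambda betahat ->
      (n%:R * T%:R)^-1 * enorm (blockdiag X *m (betahat - betastar)) ^+ 2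
        <= 8 * Num.sqrt 2 * sigma / Num.sqrt (n%:R * T%:R)
           * Num.sqrt (1 + A * ln M%:R / T%:R) * norm21 betastar)
  /\
  (forall (s : nat) (kappa : R),
    (1 <= s <= M)%N -> (#|supp betastar| <= s)%N -> RE_MT X s kappa ->
    with_prob_at_least P (1 - 2 * M%:R `^ (1 - 2 * A / 5)) (fun omega =>
      forall betahat : stacked R T M,
        MT_solution X (y^~ omega) lambda betahat ->
        [/\ (n%:R * T%:R)^-1 * enorm (blockdiag X *m (betahat - betastar)) ^+ 2
              <= 128 * sigma ^+ 2 / kappa ^+ 2 * (s%:R / n%:R)
                 * (1 + A * ln M%:R / T%:R),
            (Num.sqrt T%:R)^-1 * norm21 (betahat - betastar)
              <= 32 * Num.sqrt 2 * sigma / kappa ^+ 2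
                 * (s%:R / Num.sqrt n%:R)
                 * Num.sqrt (1 + A * ln M%:R / T%:R) &
            forall phi : R, largest_eigenvalue (gram X) phi ->
              #|supp betahat|%:R <= 64 * phi / kappa ^+ 2 * s%:R])
    /\
    (forall kappa2 : R, RE_MT X (2 * s) kappa2 ->
      with_prob_at_least P (1 - 2 * M%:R `^ (1 - 2 * A / 5)) (fun omega =>
        forall betahat : stacked R T M,
          MT_solution X (y^~ omega) lambda betahat ->
          (Num.sqrt T%:R)^-1 * enorm (betahat - betastar)
            <= 16 * Num.sqrt 5 * sigma / kappa2 ^+ 2 * Num.sqrt (s%:R / n%:R)
               * Num.sqrt (1 + A * ln M%:R / T%:R)))).
Proof.
have n0 : (0 < n)%N by [].
have T0 : (0 < T)%N by [].
have M0 : (0 < M)%N by exact: ltnW.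
have nR : 0 < n%:R :> R by rewrite ltr0n.
have TR : 0 < T%:R :> R by rewrite ltr0n.
have A0 : 0 <= A by lra.
have lnM : 0 <= ln M%:R :> R by rewrite ln_ge0// ler1n.
set L := 1 + A * ln M%:R / T%:R in hlambda *.
have L0 : 0 < L.
  by rewrite /L ltr_pwDl// divr_ge0 ?mulr_ge0.
set G := blockdiag X; set c := (n%:R * T%:R)^-1.
have c0 : 0 < c by rewrite invr_gt0 mulr_gt0.
have l0 : 0 < lambda := lambda_gt0 T0 n0 hsigma L0 hlambda.
(* The same event [E] witnesses all the probability statements; on it the bounds are
   deterministic. *)
have [E [mE PE hE]] := noise_event n0 M0 hsigma A0 hWindep hWnormal hdiag.
pose noise omega : 'cV[R]_(\sum_(t < T) n) :=
  \mxcol_t (\col_(i < n) W t i omega).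
have min_obj omega bh : MT_solution X (y^~ omega) lambda bh -> forall b,
    c * enorm (G *m bh - (G *m betastar + noise omega)) ^+ 2
      + 2 * lambda * norm21 bh <=
    c * enorm (G *m b - (G *m betastar + noise omega)) ^+ 2
      + 2 * lambda * norm21 b.
  move=> hbh b; have := hbh b; rewrite !objectiveE.
  have -> // : \mxcol_t y t omega = G *m betastar + noise omega.
  apply/mxcolP => t; rewrite mxcolK submxcolD submxcol_blockdiag mxcolK.
  exact: hmodel.
have noise_le omega j : E omega ->
    c * enorm (feature (G^T *m noise omega) j) <= lambda / 2.
  move=> Ew; apply: (noise_level T0 n0 hsigma L0 hlambda); first exact: enorm_ge0.
  rewrite sqr_enorm; apply: le_trans (_ : _ <= n%:R * sigma ^+ 2 *
      (2 * T%:R + 2 * (A * ln M%:R))) _.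
    apply: le_trans (hE _ Ew j); rewrite le_eqVlt; apply/orP; left; apply/eqP.
    apply: eq_bigr => t _; rewrite feature_tr_blockdiag -expr2; congr (_ ^+ 2).
    by apply: eq_bigr => i _; rewrite mxE.
  rewrite le_eqVlt; apply/orP; left; apply/eqP.
  by rewrite /L; field; rewrite gt_eqF.
split.
  exists E; split=> // omega Ew bh /min_obj bh_min.
  have := slow_rate c0 l0 bh_min (fun j => noise_le omega j Ew).
  congr (_ <= _); rewrite hlambda; ring.
move=> s kappa /andP[s0 _] supp_s re; split.
  have kappa0 : 0 < kappa by case: re.
  have k0 : 0 < kappa * Num.sqrt n%:R by rewrite mulr_gt0 ?sqrtr_gt0.
  have re' := RE_MT_restricted_eigenvalue n0 re.
  exists E; split=> // omega Ew bh /min_obj bh_min.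
  have nz j := noise_le omega j Ew.
  have fast := fast_rate c0 l0 bh_min nz k0 supp_s re'.
  split.
  - by move: fast; rewrite (fast_rate_constant T0 n0 L0 hlambda).
  - rewrite -(norm21_rate_constant T0 n0 hlambda)//.
    rewrite ler_pM2l ?invr_gt0 ?sqrtr_gt0// -/c.
    exact: (norm21_rate c0 l0 bh_min nz k0 supp_s re').
  - move=> phi hphi; have phi0 := largest_eigenvalue_ge0 n0 T0 M0 hphi.
    have np0 : 0 <= n%:R * phi by rewrite mulr_ge0 ?(ltW nR).
    have := sparsity_bound c0 l0 bh_min nz np0
      (fun v => sqr_enorm_blockdiag_le v n0 hphi).
    have l2 : 0 < lambda ^+ 2 by rewrite exprn_gt0.
    move=> h; rewrite -(ler_pM2r l2); apply: le_trans h _.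
    (* Both sides of the sparsity bound are factored through [4 * c * (n%:R * phi)], so that the
       comparison reduces to the fast rate; 64 is 4 times 16. *)
    have -> : 64 * phi / kappa ^+ 2 * s%:R * lambda ^+ 2 = 4 * c * (n%:R * phi) *
        (16 * lambda ^+ 2 * s%:R / (c * (kappa * Num.sqrt n%:R) ^+ 2)).
      rewrite exprMn sqr_sqrtr ?ltW//.
      by field; rewrite !gt_eqF.
    have -> : 4 * c ^+ 2 * (n%:R * phi * enorm (G *m (bh - betastar)) ^+ 2) =
        4 * c * (n%:R * phi) * (c * enorm (G *m (bh - betastar)) ^+ 2) by ring.
    by rewrite ler_wpM2l ?mulr_ge0// ltW.
move=> kappa2 re2.
have kappa0 : 0 < kappa2 by case: re2.
have k0 : 0 < kappa2 * Num.sqrt n%:R by rewrite mulr_gt0 ?sqrtr_gt0.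
have re' := RE_MT_restricted_eigenvalue n0 re2.
exists E; split=> // omega Ew bh /min_obj bh_min.
have nz j := noise_le omega j Ew.
rewrite -(enorm_rate_constant T0 n0 hlambda)//.
rewrite ler_pM2l ?invr_gt0 ?sqrtr_gt0// -/c.
exact: (enorm_rate c0 l0 bh_min nz k0 supp_s s0 re').
Qed.
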